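(* Let $\Sigma\subset\mathbb{L}(\mathbb{R}^3)=T\mathbb{S}^2$ be a rotationally symmetric Lagrangian section on which the metric induced by the canonical neutral metric $\mathbb{G}$ is non-degenerate. Then $\Sigma$ is marginally trapped, i.e. its mean curvature vector $\vec H$ satisfies $\mathbb{G}(\vec H,\vec H)=0$ at every point.
   Context: The space $\mathbb{L}(\mathbb{R}^3)$ of oriented lines in Euclidean 3-space is identified with $T\mathbb{S}^2$. Let $\xi$ be the holomorphic coordinate on $\mathbb{S}^2$ given by stereographic projection from the South pole onto the plane through the equator, and let $(\xi,\eta)$ be the induced canonical holomorphic coordinates on $T\mathbb{S}^2$, where $(\xi,\eta)$ stands for the tangent vector $\eta\,\partial/\partial\xi+\bar\eta\,\partial/\partial\bar\xi$ at $\xi$. The canonical neutral (signature $(2,2)$) metric and symplectic form are $$\mathbb{G}=\frac{2i}{(1+\xi\bar\xi)^2}\Big(d\eta\otimes d\bar\xi-d\bar\eta\otimes d\xi+\frac{2(\xi\bar\eta-\bar\xi\eta)}{1+\xi\bar\xi}\,d\xi\otimes d\bar\xi\Big),$$ $$\Omega=\frac{2}{(1+\xi\bar\xi)^2}\Big(d\eta\wedge d\bar\xi+d\bar\eta\wedge d\xi+\frac{2(\xi\bar\eta-\bar\xi\eta)}{1+\xi\bar\xi}\,d\xi\wedge d\bar\xi\Big),$$ where in $\mathbb{G}$ the products of one-forms are understood as symmetrised. A (local) section is a surface $\Sigma$ given by a graph $\xi\mapsto(\xi,\eta=F(\xi,\bar\xi))$ with $F$ a smooth complex function. It is Lagrangian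 if $\Omega|_\Sigma=0$; this is equivalent to the existence of a real function $r$ (the support function) with $F=\tfrac12(1+\xi\bar\xi)^2\,\partial r/\partial\bar\xi$. The induced metric is non-degenerate exactly where $\sigma=-\partial\bar F/\partial\xi\neq0$. A Lagrangian section is rotationally symmetric if, after a suitable rotation, its support function is invariant under $\xi\mapsto e^{i\beta}\xi$ for all $\beta\in[0,2\pi)$. A surface is marginally trapped if its mean curvature vector (the trace of the second fundamental form with respect to the induced metric) is null; the zero vector counts as null. All objects are smooth. *)

(* Defs.v *)
From mathcomp Require Import all_boot all_order all_algebra.
From mathcomp Require Import complex ring.
From mathcomp Require Import all_classical all_reals all_analysis.
Set Implicit Arguments.
Unset Strict Implicit.
Unset Printing Implicit Defensive.
Import Order.TTheory GRing.Theory Num.Theory.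
Import numFieldNormedType.Exports.
Local Open Scope classical_set_scope.
Local Open Scope ring_scope.

Section Smoothness.
Context {R : realType} {m : nat}.

Definition partial (i : 'I_m) (f : 'rV[R]_m -> R) (u : 'rV[R]_m) : R :=
  'D_(delta_mx 0 i) f u.

Fixpoint Cn_on (n : nat) (U : set 'rV[R]_m) (f : 'rV[R]_m -> R) : Prop :=
  if n is n'.+1 then
    (forall u, U u -> differentiable f u) /\
    (forall i, Cn_on n' U (partial i f))
  else forall u, U u -> {for u, continuous f}.

Definition smooth_on (U : set 'rV[R]_m) (f : 'rV[R]_m -> R) : Prop :=
  forall n, Cn_on n U f.

End Smoothness.

(* A pseudo-Riemannian metric on a coordinate chart of dimension n is given by
   its Gram matrix g p at each point p, and an immersion of an m-dimensional
   manifold by X : 'rV_m -> 'rV_n.  Inverse matrices are taken with invmx, so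
   that the notions below are meaningful only where g, and the metric induced
   by X, are invertible. *)
Section PseudoRiemannian.
Context {R : realType} {n m : nat}.
Variables (g : 'rV[R]_n -> 'M[R]_n) (X : 'rV[R]_m -> 'rV[R]_n).

Definition metric (p V W : 'rV[R]_n) : R := (V *m g p *m W^T) 0 0.

(* Gamma^k_{ij} of the Levi-Civita connection *)
Definition christoffel (p : 'rV[R]_n) (k i j : 'I_n) : R :=
  2^-1 * \sum_l invmx (g p) k l *
    (partial i (fun q => g q j l) p + partial j (fun q => g q i l) p
     - partial l (fun q => g q i j) p).

Definition tangent (a : 'I_m) (u : 'rV[R]_m) : 'rV[R]_n :=
  \row_k partial a (fun v => X v 0 k) u.

Definition induced_metric (u : 'rV[R]_m) : 'M[R]_m :=
  \matrix_(a, b) metric (X u) (tangent a u) (tangent b u).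

Definition nondegenerate_on (U : set 'rV[R]_m) : Prop :=
  forall u, U u -> induced_metric u \in unitmx.

(* Levi-Civita derivative of the tangent field tangent b along tangent a *)
Definition covariant (a b : 'I_m) (u : 'rV[R]_m) : 'rV[R]_n :=
  \row_k (partial a (fun v => tangent b v 0 k) u +
    \sum_i \sum_j christoffel (X u) k i j * tangent a u 0 i * tangent b u 0 j).

Definition normal_part (u : 'rV[R]_m) (V : 'rV[R]_n) : 'rV[R]_n :=
  V - \sum_a \sum_b
    (invmx (induced_metric u) a b * metric (X u) V (tangent a u)) *: tangent b u.

Definition second_fundamental_form (a b : 'I_m) (u : 'rV[R]_m) : 'rV[R]_n :=
  normal_part u (covariant a b u).

Definition mean_curvature (u : 'rV[R]_m) : 'rV[R]_n :=
  \sum_a \sum_b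
    invmx (induced_metric u) a b *: second_fundamental_form a b u.

Definition marginally_trapped_on (U : set 'rV[R]_m) : Prop :=
  forall u, U u -> metric (X u) (mean_curvature u) (mean_curvature u) = 0.

End PseudoRiemannian.

Section OrientedLines.
Context {R : realType}.
Local Open Scope complex_scope.
Implicit Types (z : R[i]) (u : 'rV[R]_2) (p V W : 'rV[R]_(2 + 2)).

Definition toC u : R[i] := u 0 0 +i* u 0 1.
Definition ofC z : 'rV[R]_2 := \row_k [:: complex.Re z; complex.Im z]`_k.

(* The real coordinates on the chart of T S^2 are
   (Re xi, Im xi, Re eta, Im eta). *)
Definition xi p : R[i] := toC (lsubmx p).
Definition eta p : R[i] := toC (rsubmx p).

(* xi and eta are real-linear in the coordinates, so each is its own
   differential. *)
Definition dxi V : R[i] := xi V.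
Definition deta V : R[i] := eta V.
Definition dxibar V : R[i] := (dxi V)^*%C.
Definition detabar V : R[i] := (deta V)^*%C.

(* With the other normalisation (no factor 1/2) the metric would be doubled,
   which changes neither the mean curvature's nullity nor nondegeneracy. *)
Definition symprod (a b : 'rV[R]_(2 + 2) -> R[i]) V W : R[i] :=
  (a V * b W + b V * a W) / 2.
Definition wedge (a b : 'rV[R]_(2 + 2) -> R[i]) V W : R[i] :=
  a V * b W - b V * a W.

Definition neutral_form p V W : R[i] :=
  2 * 'i%C / (1 + xi p * (xi p)^*%C) ^+ 2 *
  (symprod deta dxibar V W - symprod detabar dxi V W +
   2 * (xi p * (eta p)^*%C - (xi p)^*%C * eta p) / (1 + xi p * (xi p)^*%C) *
     symprod dxi dxibar V W).

Definition Omega p V W : R[i] :=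
  2 / (1 + xi p * (xi p)^*%C) ^+ 2 *
  (wedge deta dxibar V W + wedge detabar dxi V W +
   2 * (xi p * (eta p)^*%C - (xi p)^*%C * eta p) / (1 + xi p * (xi p)^*%C) *
     wedge dxi dxibar V W).

Lemma conjc_neutral_form p V W : (neutral_form p V W)^*%C = neutral_form p V W.
Proof.
have conjM (z w : R[i]) : (z * w)^*%C = z^*%C * w^*%C by exact: rmorphM.
have conjD (z w : R[i]) : (z + w)^*%C = z^*%C + w^*%C by exact: rmorphD.
have conjN (z : R[i]) : (- z)^*%C = - z^*%C by exact: rmorphN.
have conji : ('i%C)^*%C = - 'i%C :> R[i].
  by apply/eqP; rewrite eq_complex /= oppr0 !eqxx.
rewrite /neutral_form /symprod /detabar /dxibar expr2.
move: (xi p) (eta p) (dxi V) (deta V) (dxi W) (deta W) => x e a b a' b'.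
rewrite !(conjM, conjD, conjN, conjc_inv, conji, conjcK, conjc1, conjc_nat).
rewrite (mulrC x^*%C x); move: (1 + _) => D; ring.
Qed.

(* By conjc_neutral_form, taking the real part loses nothing. *)
Definition neutral_metric p : 'M[R]_(2 + 2) :=
  \matrix_(i, j) complex.Re (neutral_form p (delta_mx 0 i) (delta_mx 0 j)).

Definition graph (F : 'rV[R]_2 -> R[i]) u : 'rV[R]_(2 + 2) :=
  row_mx u (ofC (F u)).

Definition smooth_section (U : set 'rV[R]_2) (F : 'rV[R]_2 -> R[i]) : Prop :=
  [/\ open U, smooth_on U (fun u => complex.Re (F u))
    & smooth_on U (fun u => complex.Im (F u))].

Definition lagrangian_on (U : set 'rV[R]_2) (F : 'rV[R]_2 -> R[i]) : Prop :=
  forall u, U u -> forall a b,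
    Omega (graph F u) (tangent (graph F) a u) (tangent (graph F) b u) = 0.

(* the Wirtinger derivative d/d(xi bar) of a real function *)
Definition dbar (r : 'rV[R]_2 -> R) u : R[i] :=
  (partial 0 r u +i* partial 1 r u) / 2.

Definition support_function (U : set 'rV[R]_2) (F : 'rV[R]_2 -> R[i])
    (r : 'rV[R]_2 -> R) : Prop :=
  smooth_on U r /\
  forall u, U u -> F u = (1 + toC u * (toC u)^*%C) ^+ 2 / 2 * dbar r u.

(* the point of the unit sphere with stereographic coordinate z, projecting
   from the South pole (0, 0, -1) *)
Definition sphere_point z : 'cV[R]_3 :=
  let x := complex.Re z in let y := complex.Im z in
  \col_k ([:: 2 * x; 2 * y; 1 - x ^+ 2 - y ^+ 2]`_k / (1 + x ^+ 2 + y ^+ 2)).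

Definition is_rotation (A : 'M[R]_3) : Prop := A *m A^T = 1%:M /\ \det A = 1.

Definition expi (beta : R) : R[i] := cos beta +i* sin beta.

(* A acts on a support function r by moving it from the direction
   sphere_point (toC u) to A *m sphere_point (toC u), so that the rotated
   function takes at z the value r u whenever these two directions agree.  As
   U may be any open set, the invariance is imposed on all pairs of points of U
   that the rotation relates; U itself is not required to be invariant. *)
Definition rotationally_symmetric (U : set 'rV[R]_2)
    (F : 'rV[R]_2 -> R[i]) : Prop :=
  exists r : 'rV[R]_2 -> R, support_function U F r /\
  exists A : 'M[R]_3, is_rotation A /\
  forall (beta : R) (z : R[i]) (u v : 'rV[R]_2),
    0 <= beta < 2 * pi -> U u -> U v ->
    sphere_point z = A *m sphere_point (toC u) ->
    sphere_point (expi beta * z) = A *m sphere_point (toC v) ->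
    r v = r u.

End OrientedLines.

(* Main.v *)
Require Import Defs.
From mathcomp Require Import all_boot all_order all_algebra.
From mathcomp Require Import complex ring lra.
From mathcomp Require Import all_classical all_reals all_analysis.
Set Implicit Arguments.
Unset Strict Implicit.
Unset Printing Implicit Defensive.
Import Order.TTheory GRing.Theory Num.Theory.
Import numFieldNormedType.Exports.
Local Open Scope classical_set_scope.
Local Open Scope ring_scope.

(* Let r be the support function, S and T the coefficients of the induced metric
   - S dx^2 + T dx dy + S dy^2, e_1, e_2 the coordinate tangent frame and J the
   complex structure of T S^2. Since J is an isometry taking tangent to normal
   vectors, the normal frame J e_1, J e_2 has the Gram matrix of the induced
   metric, and up to a nonzero factor
     G(H, H) = - S N_1^2 + T N_1 N_2 + S N_2^2,    N_a = G(tr nabla e, J e_a).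
   The invariance of r gives K r = 0 for a nonzero Killing field K of the
   sphere, whose derivatives of order at most two have two consequences. Where K
   does not vanish, K is a null vector of the induced metric and (N_1, N_2) is
   parallel to K, so that G(H, H) = 0. Where K vanishes, S = T = 0, which
   nondegeneracy excludes. *)

(** * Algebra of the jets of a support function *)

Section JetAlgebra.
Context {R : realFieldType}.

(** S is the component Hess r(1,2) and T the difference Hess r(1,1) - Hess r(2,2), for the Hessian
    of the round sphere, so the induced metric sends V to - Hess r(V, iV), where i is the quarter
    turn of the (x, y)-plane. Differentiating K r = 0 along V gives Hess r(K, V) = - dr(nabla_V K),
    and nabla_V K = f iV for a Killing field; V = iK yields Hess r(K, iK) = f dr(K) = 0, so K and iK
    are both null. The parallelism reflects a hidden symmetry: the reflection in the plane through
    the axis and the given direction locally preserves the section, changes the sign of G and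
    anticommutes with J. The trace being taken with the metric, the reflection reverses H, so the
    covector N vanishes on iK, that is, k1 N2 = k2 N1. Since U need not be invariant under any
    rotation, the proof keeps only the 2-jet of K r = 0 at a point, and rational identities replace
    this argument. *)

Definition conformal (x y : R) : R := 1 + x ^+ 2 + y ^+ 2.

Lemma conformal_neq0 x y : conformal x y != 0.
Proof. by rewrite gt_eqF// /conformal -addrA ltr_wpDr// addr_ge0// sqr_ge0. Qed.

(* With n = (n1, n2, n3), the rotation field v |-> n x v of the unit sphere is
   rot_field1 d/dx + rot_field2 d/dy in the stereographic chart. *)
Definition rot_field1 (n1 n2 n3 x y : R) : R :=
  n2 * (1 + x ^+ 2 - y ^+ 2) / 2 - n3 * y - n1 * x * y.
Definition rot_field2 (n1 n2 n3 x y : R) : R :=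
  n3 * x - n1 * (1 - x ^+ 2 + y ^+ 2) / 2 + n2 * x * y.

Variables (x y r1 r2 r11 r12 r22 r111 r112 r122 r222 : R).
Local Notation D := (conformal x y).

(* The metric induced on the section with support function r is
   - S dx^2 + T dx dy + S dy^2. *)
Definition jetS : R := r12 + 2 * (x * r2 + y * r1) / D.
Definition jetT : R := r11 - r22 + 4 * (x * r1 - y * r2) / D.

(* The components 111, 112, 122 and 222 of the totally symmetric cubic form
   G(nabla_a e_b, J e_c). *)
Definition jetC0 : R := r111 / 2 + 3 * (x * r11 - y * r12) / D
  + (3 * (1 + x ^+ 2 - y ^+ 2) * r1 - 6 * x * y * r2) / D ^+ 2.
Definition jetC1 : R := r112 / 2 + (2 * y * r11 + 3 * x * r12 - y * r22) / D
  + (6 * x * y * r1 + (1 + 3 * x ^+ 2 - 3 * y ^+ 2) * r2) / D ^+ 2.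
Definition jetC2 : R := r122 / 2 + (- x * r11 + 3 * y * r12 + 2 * x * r22) / D
  + ((1 - 3 * x ^+ 2 + 3 * y ^+ 2) * r1 + 6 * x * y * r2) / D ^+ 2.
Definition jetC3 : R := r222 / 2 + 3 * (- x * r12 + y * r22) / D
  + (- 6 * x * y * r1 + 3 * (1 - x ^+ 2 + y ^+ 2) * r2) / D ^+ 2.

(* The derivatives of order 0, 1 and 2 of the equation k1 r_x + k2 r_y = 0 when
   k1_x = k2_y = a, k1_y = - k2_x = b, a_x = - b_y = n2 and a_y = b_x = - n1. *)
Definition killing_jet (k1 k2 a b n1 n2 : R) : Prop :=
  [/\ k1 * r1 + k2 * r2 = 0,
      k1 * r11 + k2 * r12 + (a * r1 - b * r2) = 0,
      k1 * r12 + k2 * r22 + (b * r1 + a * r2) = 0 &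
  [/\ k1 * r111 + k2 * r112 + 2 * (a * r11 - b * r12) + n2 * r1 + n1 * r2 = 0,
      k1 * r112 + k2 * r122 + (a * r12 - b * r22) + (b * r11 + a * r12)
        + (- n1 * r1 + n2 * r2) = 0 &
      k1 * r122 + k2 * r222 + 2 * (b * r12 + a * r22)
        + (- n2 * r1 - n1 * r2) = 0]].

End JetAlgebra.

(* The field K = (k1, k2) is null for the induced metric, and the vector with
   components N1 = - S (C0 - C2) + T C1 and N2 = - S (C1 - C3) + T C2, which up
   to a factor represents the mean curvature, is parallel to K. *)
Lemma killing_jet_parallel {R : realFieldType}
    (x y k1 k2 b n1 n2 r1 r2 r11 r12 r22 r111 r112 r122 r222 : R) :
  let D := conformal x y in
  n1 = - 2 * (k2 + x * b) / D -> n2 = 2 * (k1 - y * b) / D ->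
  killing_jet r1 r2 r11 r12 r22 r111 r112 r122 r222
    k1 k2 (2 * (x * k1 + y * k2) / D) b n1 n2 ->
  k2 != 0 ->
  let S := jetS x y r1 r2 r12 in let T := jetT x y r1 r2 r11 r22 in
  let C0 := jetC0 x y r1 r2 r11 r12 r111 in
  let C1 := jetC1 x y r1 r2 r11 r12 r22 r112 in
  let C2 := jetC2 x y r1 r2 r11 r12 r22 r122 in
  let C3 := jetC3 x y r1 r2 r12 r22 r222 in
  - S * k1 ^+ 2 + T * k1 * k2 + S * k2 ^+ 2 = 0 /\
  k1 * (- S * (C1 - C3) + T * C2) = k2 * (- S * (C0 - C2) + T * C1).
Proof.
move=> D n1E n2E [e0 e1 e2 [f1 f2 f3]] k20 S T C0 C1 C2 C3.
set a := 2 * _ / D in e1 e2 f1 f2 f3.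
(* As [k2] is invertible, each equation of the jet is solved for its derivative with the most y's.
   This leaves [r1], [r11] and [r111] free, and the claims become identities of rational
   functions. *)
have r2E : r2 = - (k1 * r1) / k2.
  by apply/(canRL (mulfK k20)); rewrite -[LHS]subr0 -e0; ring.
have r12E : r12 = - (k1 * r11 + (a * r1 - b * r2)) / k2.
  by apply/(canRL (mulfK k20)); rewrite -[LHS]subr0 -e1; ring.
have r22E : r22 = - (k1 * r12 + (b * r1 + a * r2)) / k2.
  by apply/(canRL (mulfK k20)); rewrite -[LHS]subr0 -e2; ring.
have r112E : r112 = - (k1 * r111 + 2 * (a * r11 - b * r12)
    + n2 * r1 + n1 * r2) / k2.
  by apply/(canRL (mulfK k20)); rewrite -[LHS]subr0 -f1; ring.
have r122E : r122 = - (k1 * r112 + (a * r12 - b * r22) + (b * r11 + a * r12)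
    + (- n1 * r1 + n2 * r2)) / k2.
  by apply/(canRL (mulfK k20)); rewrite -[LHS]subr0 -f2; ring.
have r222E : r222 = - (k1 * r122 + 2 * (b * r12 + a * r22)
    + (- n2 * r1 - n1 * r2)) / k2.
  by apply/(canRL (mulfK k20)); rewrite -[LHS]subr0 -f3; ring.
have D0 : 1 + x ^+ 2 + y ^+ 2 != 0 := conformal_neq0 x y.
rewrite /C0 /C1 /C2 /C3 /S /T /jetC0 /jetC1 /jetC2 /jetC3 /jetS /jetT.
rewrite r222E r122E r112E n1E n2E r22E r12E r2E /a /D /conformal.
by split; field; apply/andP.
Qed.

Lemma killing_jet_null {R : realFieldType}
    (x y n1 n2 n3 r1 r2 r11 r12 r22 r111 r112 r122 r222 : R) :
  ~ [/\ n1 = 0, n2 = 0 & n3 = 0] ->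
  killing_jet r1 r2 r11 r12 r22 r111 r112 r122 r222
    (rot_field1 n1 n2 n3 x y) (rot_field2 n1 n2 n3 x y)
    (n2 * x - n1 * y) (- n3 - n1 * x - n2 * y) n1 n2 ->
  let S := jetS x y r1 r2 r12 in let T := jetT x y r1 r2 r11 r22 in
  let C0 := jetC0 x y r1 r2 r11 r12 r111 in
  let C1 := jetC1 x y r1 r2 r11 r12 r22 r112 in
  let C2 := jetC2 x y r1 r2 r11 r12 r22 r122 in
  let C3 := jetC3 x y r1 r2 r12 r22 r222 in
  let N1 := - S * (C0 - C2) + T * C1 in let N2 := - S * (C1 - C3) + T * C2 in
  S ^+ 2 + T ^+ 2 / 4 != 0 ->
  - S * N1 ^+ 2 + T * N1 * N2 + S * N2 ^+ 2 = 0.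
Proof.
move=> n0 kj S T C0 C1 C2 C3 N1 N2 ST; move: kj.
set k1 := rot_field1 _ _ _ _ _; set k2 := rot_field2 _ _ _ _ _.
set a := n2 * x - _; set b := - n3 - _ - _ => kj.
have D0 := conformal_neq0 x y; set D := conformal x y in D0.
(* A Killing field is determined by its 1-jet at a point. Trading the axis for [k1], [k2] and [b]
   makes [k2] an independent variable by which [field] can divide. *)
have n1E : n1 = - 2 * (k2 + x * b) / D.
  by rewrite /k2 /b /rot_field2; move: D0; rewrite /D /conformal => D0; field.
have n2E : n2 = 2 * (k1 - y * b) / D.
  by rewrite /k1 /b /rot_field1; move: D0; rewrite /D /conformal => D0; field.
have aE : a = 2 * (x * k1 + y * k2) / D.
  rewrite /k1 /k2 /a /rot_field1 /rot_field2.
  by move: D0; rewrite /D /conformal => D0; field.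
have parallel : (k1 != 0) || (k2 != 0) ->
    - S * k1 ^+ 2 + T * k1 * k2 + S * k2 ^+ 2 = 0 -> k1 * N2 = k2 * N1 ->
    - S * N1 ^+ 2 + T * N1 * N2 + S * N2 ^+ 2 = 0.
  move=> /orP[k0|k0] hK NK.
    have -> : N2 = k2 * N1 / k1 by apply/(canRL (mulfK k0)); rewrite mulrC.
    transitivity ((- S * k1 ^+ 2 + T * k1 * k2 + S * k2 ^+ 2) * (N1 / k1) ^+ 2).
      by field.
    by rewrite hK mul0r.
  have -> : N1 = k1 * N2 / k2 by apply/(canRL (mulfK k0)); rewrite mulrC.
  transitivity ((- S * k1 ^+ 2 + T * k1 * k2 + S * k2 ^+ 2) * (N2 / k2) ^+ 2).
    by field.
  by rewrite hK mul0r.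
have [k20|k20] := eqVneq k2 0; last first.
  rewrite aE in kj; have [hK NK] := killing_jet_parallel n1E n2E kj k20.
  by apply: parallel; rewrite ?k20 ?orbT.
case: (kj) => e0 e1 e2 [f1 f2 f3].
have [k10|k10] := eqVneq k1 0; last first.
  (* The reflection exchanging x and y reduces this case to the previous one. *)
  have DC : conformal y x = D by rewrite /D /conformal addrAC.
  (* The axis is a pseudovector: exchanging x and y takes (n1, n2) to (-n2, -n1), and the rotation
     rate b to -b. *)
  have n1E' : - n2 = - 2 * (k1 + y * - b) / conformal y x.
    by rewrite DC n2E; field.
  have n2E' : - n1 = 2 * (k2 - x * - b) / conformal y x.
    by rewrite DC n1E; field.
  have aE' : 2 * (y * k2 + x * k1) / conformal y x = a by rewrite DC aE; field.
  have kj' : killing_jet r2 r1 r22 r12 r11 r222 r122 r112 r111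
      k2 k1 (2 * (y * k2 + x * k1) / conformal y x) (- b) (- n2) (- n1).
    by rewrite aE'; split; [rewrite -[RHS]e0|rewrite -[RHS]e2|rewrite -[RHS]e1|
      split; [rewrite -[RHS]f3|rewrite -[RHS]f2|rewrite -[RHS]f1]]; ring.
  have [hK NK] := killing_jet_parallel n1E' n2E' kj' k10.
  apply: parallel; first by rewrite k10.
    transitivity (- (0 : R)); last exact: oppr0.
    by rewrite -[in RHS]hK /S /T /jetS /jetT DC -/D; field.
  apply/eqP; rewrite -subr_eq0; apply/eqP.
  move/eqP: NK; rewrite -subr_eq0 => /eqP <-.
  rewrite /N1 /N2 /S /T /C0 /C1 /C2 /C3 /jetS /jetT /jetC0 /jetC1 /jetC2 /jetC3.
  by rewrite DC -/D; field.
(* At a zero of K the Hessian of r is a multiple of the metric of the sphere. *)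
have a0 : a = 0 by rewrite aE k10 k20; field.
(* A Killing field whose 1-jet vanishes at a point is zero, against [n0]. *)
have b0 : b != 0.
  apply/eqP => b0; apply: n0.
  have n10 : n1 = 0 by rewrite n1E k20 b0; field.
  have n20 : n2 = 0 by rewrite n2E k10 b0; field.
  by split=> //; apply/eqP; rewrite -oppr_eq0 -b0 /b n10 n20; apply/eqP; ring.
have bI z : b * z = 0 -> z = 0.
  by move/eqP; rewrite mulf_eq0 (negbTE b0) => /eqP.
have r20 : r2 = 0.
  by apply: bI; rewrite -[RHS]oppr0 -e1 k10 k20 a0; ring.
have r10 : r1 = 0 by apply: bI; rewrite -[RHS]e2 k10 k20 a0; ring.
have r120 : r12 = 0.
  by apply: bI; rewrite -[RHS](mulr0 (- 2^-1)) -f1 k10 k20 a0 r10 r20; field.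
have r1122 : r11 - r22 = 0.
  by apply: bI; rewrite -[RHS]f2 k10 k20 a0 r10 r20; ring.
move: ST; rewrite /S /T /jetS /jetT r1122 r120 r10 r20.
by rewrite !(mulr0, mul0r, subr0, addr0) expr0n /= mul0r addr0 eqxx.
Qed.

(** * Submanifolds of pseudo-Riemannian charts *)

Lemma ord2P (P : 'I_2 -> Prop) : P 0 -> P 1 -> forall k, P k.
Proof.
move=> P0 P1; case=> -[|[|//]] k; [move: P0|move: P1]; congr P; exact: val_inj.
Qed.

Lemma sum2 (V : nmodType) (f : 'I_2 -> V) : \sum_i f i = f 0 + f 1.
Proof. by rewrite !big_ord_recl big_ord0 addr0; congr (f _ + f _);
  exact: val_inj. Qed.

Section PseudoRiemannianTheory.
Context {R : realType} {n m : nat}.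
Variables (g : 'rV[R]_n -> 'M[R]_n) (X : 'rV[R]_m -> 'rV[R]_n).

Lemma metricE p V W : metric g p V W = \sum_j (\sum_i V 0 i * g p i j) * W 0 j.
Proof. by rewrite /metric !mxE; apply: eq_bigr => j _; rewrite !mxE. Qed.

Lemma metricDl p U V W : metric g p (U + V) W = metric g p U W + metric g p V W.
Proof. by rewrite /metric !mulmxDl mxE. Qed.

Lemma metricZl p a V W : metric g p (a *: V) W = a * metric g p V W.
Proof. by rewrite /metric -!scalemxAl mxE. Qed.

Lemma metric_suml p (I : finType) (V : I -> 'rV[R]_n) W :
  metric g p (\sum_i V i) W = \sum_i metric g p (V i) W.
Proof. by rewrite /metric !mulmx_suml summxE. Qed.

(** Lowering the upper index cancels the inverse metric, so that no entry of [invmx (g p)] is ever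
    computed. *)
Lemma christoffel_lower p i j l : (g p)^T = g p -> g p \in unitmx ->
  \sum_k christoffel g p k i j * g p k l =
  2^-1 * (partial i (fun q => g q j l) p + partial j (fun q => g q i l) p
     - partial l (fun q => g q i j) p).
Proof.
move=> gT gU; pose c l := partial i (fun q => g q j l) p
   + partial j (fun q => g q i l) p - partial l (fun q => g q i j) p.
transitivity (2^-1 * \sum_t (\sum_k g p l k * invmx (g p) k t) * c t).
  rewrite mulr_sumr.
  under eq_bigr do rewrite /christoffel mulr_sumr mulr_suml.
  rewrite exchange_big; apply: eq_bigr => l' _.
  rewrite mulr_suml mulr_sumr; apply: eq_bigr => k _.
  by rewrite -[in g p l k]gT mxE /c; ring.
congr (_ * _); rewrite (bigD1 l)//= [X in _ + X]big1 => [|l' ll'].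
  have := congr1 (fun M : 'M[R]_n => M l l) (mulmxV gU).
  by rewrite !mxE eqxx /= => ->; rewrite mul1r addr0.
have := congr1 (fun M : 'M[R]_n => M l l') (mulmxV gU).
by rewrite !mxE eq_sym (negbTE ll') /= => ->; rewrite mul0r.
Qed.

Lemma metric_covariant a b u W : (g (X u))^T = g (X u) -> g (X u) \in unitmx ->
  metric g (X u) (covariant g X a b u) W =
  metric g (X u) (\row_k partial a (fun v => tangent X b v 0 k) u) W
  + 2^-1 * \sum_i \sum_j \sum_l (partial i (fun q => g q j l) (X u)
     + partial j (fun q => g q i l) (X u) - partial l (fun q => g q i j) (X u))
     * tangent X a u 0 i * tangent X b u 0 j * W 0 l.
Proof.
move=> gT gU; set A := tangent X a u; set B := tangent X b u.
have -> : covariant g X a b u = \row_k partial a (fun v => tangent X b v 0 k) u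
    + \sum_i \sum_j (A 0 i * B 0 j) *: \row_k christoffel g (X u) k i j.
  apply/rowP => k; rewrite !mxE summxE; congr (_ + _); apply: eq_bigr => i _.
  by rewrite summxE; apply: eq_bigr => j _; rewrite !mxE; ring.
rewrite metricDl metric_suml mulr_sumr; congr (_ + _); apply: eq_bigr => i _.
rewrite metric_suml mulr_sumr; apply: eq_bigr => j _.
rewrite metricZl metricE mulr_sumr mulr_sumr; apply: eq_bigr => l _.
rewrite (eq_bigr (fun k => christoffel g (X u) k i j * g (X u) k l)) => [|k _].
  by rewrite christoffel_lower//; ring.
by rewrite mxE.
Qed.

(** The normal projection is linear, so it can be taken once, after the trace. *)
Lemma mean_curvatureE u : mean_curvature g X u =
  normal_part g X u
    (\sum_a \sum_b invmx (induced_metric g X u) a b *: covariant g X a b u).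
Proof.
have nD V W : normal_part g X u (V + W) = normal_part g X u V + normal_part g X
  u W.
  rewrite /normal_part [RHS]addrACA -opprD -big_split /=; congr (_ + _).
  congr (- _); apply: eq_bigr => a _; rewrite -big_split /=;
    apply: eq_bigr => b _.
  by rewrite metricDl mulrDr scalerDl.
have nZ k V : normal_part g X u (k *: V) = k *: normal_part g X u V.
  rewrite /normal_part scalerBr; congr (_ - _).
  rewrite scaler_sumr; apply: eq_bigr => a _; rewrite scaler_sumr;
    apply: eq_bigr => b _.
  by rewrite metricZl scalerA mulrCA.
have n0 : normal_part g X u 0 = 0 by have := nZ 0 0; rewrite !scale0r.
rewrite /mean_curvature (big_morph (normal_part g X u) nD n0).
apply: eq_bigr => a _.
by rewrite (big_morph (normal_part g X u) nD n0); apply: eq_bigr => b _;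
  rewrite nZ.
Qed.

End PseudoRiemannianTheory.

(** * The neutral metric in real coordinates *)

Section Neutral.
Context {R : realType}.
Implicit Types p V W E : 'rV[R]_(2 + 2).

(* The indices of Re xi, Im xi, Re eta and Im eta. *)
Definition ix : 'I_(2 + 2) := lshift 2 0.
Definition iy : 'I_(2 + 2) := lshift 2 1.
Definition ia : 'I_(2 + 2) := rshift 2 0.
Definition ib : 'I_(2 + 2) := rshift 2 1.

Definition conformal_pt p : R := conformal (p 0 ix) (p 0 iy).

Definition nform p V W : R :=
  2 / conformal_pt p ^+ 2 * (V 0 ia * W 0 iy + V 0 iy * W 0 ia
                      - V 0 ib * W 0 ix - V 0 ix * W 0 ib)
  + 8 * (p 0 ix * p 0 ib - p 0 iy * p 0 ia) / conformal_pt p ^+ 3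
    * (V 0 ix * W 0 ix + V 0 iy * W 0 iy).

Local Open Scope complex_scope.
Lemma xiE p : xi p = p 0 ix +i* p 0 iy.
Proof. by rewrite /xi /toC !mxE. Qed.
Lemma etaE p : eta p = p 0 ia +i* p 0 ib.
Proof. by rewrite /eta /toC !mxE. Qed.

Lemma invc_real (a : R) : (a +i* 0)^-1 = a^-1 +i* 0.
Proof. exact: (esym (fmorphV (real_complex R) a)). Qed.

Lemma neutral_formE p V W : complex.Re (neutral_form p V W) = nform p V W.
Proof.
rewrite /neutral_form /symprod /dxibar /detabar /dxi /deta !xiE !etaE /nform.
have -> : 1 + (p 0 ix +i* p 0 iy) * (p 0 ix +i* p 0 iy)^* = conformal_pt p +i*
  0.
  by apply/eqP; rewrite eq_complex /=; apply/andP; split; apply/eqP;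
    rewrite /conformal_pt/conformal; ring.
have -> : 2 = 2 +i* 0 :> R[i] by apply/eqP; rewrite eq_complex /= addr0 !eqxx.
rewrite !exprS !invfM expr0 invr1 mulr1 !invc_real.
have := conformal_neq0 (p 0 ix) (p 0 iy); rewrite -/(conformal_pt p).
move: (conformal_pt p) => D D0; rewrite /=.
by field.
Qed.
Local Close Scope complex_scope.

Lemma neutral_metricE p i j :
  neutral_metric p i j = nform p (delta_mx 0 i) (delta_mx 0 j).
Proof. by rewrite mxE neutral_formE. Qed.

Lemma sum4 (f : 'I_(2 + 2) -> R) : \sum_i f i = f ix + f iy + (f ia + f ib).
Proof. by rewrite big_split_ord /= !big_ord_recl !big_ord0 !addr0;
  congr (f _ + f _ + (f _ + f _)); apply: val_inj. Qed.

Lemma nform_bilinear p V W :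
  \sum_j (\sum_i V 0 i * nform p (delta_mx 0 i) (delta_mx 0 j)) * W 0 j = nform
    p V W.
Proof. by rewrite !sum4 /nform !mxE /=; ring. Qed.

Lemma metric_neutral p V W : metric neutral_metric p V W = nform p V W.
Proof.
rewrite metricE -nform_bilinear; apply: eq_bigr => j _; congr (_ * _).
by apply: eq_bigr => i _; rewrite neutral_metricE.
Qed.

Lemma neutral_metric_sym p : (neutral_metric p)^T = neutral_metric p.
Proof. by apply/matrixP => i j; rewrite mxE !neutral_metricE /nform; ring. Qed.

Lemma neutral_metric_unit p : neutral_metric p \in unitmx.
Proof.
rewrite -row_free_unit; apply: inj_row_free => v v0.
have vW W : nform p v W = 0 by rewrite -metric_neutral /metric v0 mul0mx mxE.
have c0 : 2 / conformal_pt p ^+ 2 != 0 by rewrite mulf_neq0 ?invr_neq0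
  ?expf_neq0 ?conformal_neq0 ?pnatr_eq0.
have z0 a : 2 / conformal_pt p ^+ 2 * a = 0 -> a = 0.
  by move/eqP; rewrite mulf_eq0 (negbTE c0) => /eqP.
(* The fibre is totally null, so pairing with its directions isolates the base components of [v].
   Once these vanish, so does the conformal term, and the base directions isolate the fibre
   components. *)
have vx : v 0 ix = 0.
  by apply: z0; rewrite -[RHS]oppr0 -(vW (delta_mx 0 ib)) /nform !mxE /=; ring.
have vy : v 0 iy = 0.
  by apply: z0; rewrite -(vW (delta_mx 0 ia)) /nform !mxE /=; ring.
have va : v 0 ia = 0.
  by apply: z0; rewrite -[RHS](vW (delta_mx 0 iy)) /nform !mxE /= vy; ring.
have vb : v 0 ib = 0.
  by apply: z0; rewrite -[RHS]oppr0 -(vW (delta_mx 0 ix)) /nform !mxE /= vx;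
    ring.
apply/rowP => i; rewrite mxE -(splitK i).
by case: (fintype.split i) => -[[|[|//]] j] /=;
  [rewrite -[RHS]vx|rewrite -[RHS]vy|rewrite -[RHS]va|rewrite -[RHS]vb];
  congr (v 0 _); apply: val_inj.
Qed.

End Neutral.

(** * Derivation rules for pointwise expressions *)

Section DerivationRules.
Context {R : realType} {V : normedModType R}.
Implicit Types (f g : V -> R) (x v : V) (a b : R).

Lemma is_derive_funD f g x v a b : is_derive x v f a -> is_derive x v g b ->
  is_derive x v (fun t => f t + g t) (a + b).
Proof. exact: is_deriveD. Qed.

Lemma is_derive_funN f x v a : is_derive x v f a ->
  is_derive x v (fun t => - f t) (- a).
Proof. exact: is_deriveN. Qed.

Lemma is_derive_funM f g x v a b : is_derive x v f a -> is_derive x v g b ->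
  is_derive x v (fun t => f t * g t) (a * g x + f x * b).
Proof.
move=> df dg; rewrite addrC [a * _]mulrC.
exact: (is_deriveM df dg).
Qed.

Lemma is_derive_funX f n x v a : is_derive x v f a ->
  is_derive x v (fun t => f t ^+ n) (n%:R * f x ^+ n.-1 * a).
Proof. by move=> df; rewrite -[X in is_derive _ _ X _]exprfctE;
  exact: is_deriveX. Qed.

Lemma is_derive_funV f x v a : f x != 0 -> is_derive x v f a ->
  is_derive x v (fun t => (f t)^-1) (- a / f x ^+ 2).
Proof.
move=> fx0 [df fa]; split; first exact: derivableV.
by rewrite deriveV// fa mulNr mulrC -mulNr.
Qed.

Lemma is_derive_fun_cst c x v : is_derive x v (fun=> c : R) 0.
Proof. exact: is_derive_cst. Qed.

End DerivationRules.

Lemma is_derive_coord {R : realType} n (i : 'I_n) (x v : 'rV[R]_n) :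
  is_derive x v (fun t : 'rV[R]_n => t 0 i) (v 0 i).
Proof.
have df : derivable (fun t : 'rV[R]_n => t 0 i) x v.
  by apply: diff_derivable; exact: differentiable_coord.
have /derive_mx : derivable (@id 'rV[R]_n) x v by exact: derivable_id.
move=> idE; split=> //; move: idE.
by move=> /(congr1 (fun M : 'rV[R]_n => M 0 i)); rewrite derive_id mxE.
Qed.

(** The derivative is an existential variable that the rules fill in; [is_derive_eq] then compares
    it with the expected one. Trying [eassumption] first lets functions without an explicit formula
    take their derivatives from the context. *)
Ltac differentiate := repeat first
  [ eassumption
  | eapply is_derive_fun_cst
  | eapply is_derive_coord
  | eapply is_derive_funN
  | eapply is_derive_funD
  | eapply is_derive_funM
  | eapply is_derive_funX
  | eapply is_derive_funV ].

(** * Christoffel symbols of the neutral metric *)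

Section NeutralChristoffel.
Context {R : realType}.
Implicit Types p V W E A B : 'rV[R]_(2 + 2).

Definition dnform p E V W : R :=
  let D := conformal_pt p in
  let dD := 2 * (p 0 ix * E 0 ix + p 0 iy * E 0 iy) in
  - 4 * dD / D ^+ 3 * (V 0 ia * W 0 iy + V 0 iy * W 0 ia
                      - V 0 ib * W 0 ix - V 0 ix * W 0 ib)
  + (8 * (E 0 ix * p 0 ib + p 0 ix * E 0 ib
          - E 0 iy * p 0 ia - p 0 iy * E 0 ia) / D ^+ 3
     - 24 * (p 0 ix * p 0 ib - p 0 iy * p 0 ia) * dD / D ^+ 4)
    * (V 0 ix * W 0 ix + V 0 iy * W 0 iy).

Lemma is_derive_nform p E V W :
  is_derive p E (fun q => nform q V W) (dnform p E V W).
Proof.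
have D0 := conformal_neq0 (p 0 ix) (p 0 iy).
apply: is_derive_eq; first by rewrite /nform /conformal_pt /conformal;
  differentiate; rewrite expf_neq0.
rewrite /dnform /conformal_pt /=; move: D0; rewrite /conformal => D0.
by field.
Qed.

Lemma partial_neutral_metric i j l p :
  partial i (fun q => neutral_metric q j l) p =
  dnform p (delta_mx 0 i) (delta_mx 0 j) (delta_mx 0 l).
Proof.
rewrite /partial; under eq_fun do rewrite neutral_metricE.
exact: (@derive_val _ _ _ _ _ _ _ (is_derive_nform _ _ _ _)).
Qed.

Lemma dnform_trilinear p E V W :
  \sum_i \sum_j \sum_l dnform p (delta_mx 0 i) (delta_mx 0 j) (delta_mx 0 l)
    * E 0 i * V 0 j * W 0 l = dnform p E V W.
Proof.
by rewrite !sum4 /dnform !mxE /=; move: (conformal_pt p) => D; ring.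
Qed.

(** Koszul's formula for constant vector fields: it replaces the index sums by three values of a
    trilinear form, up to the factor 1/2. *)
Lemma christoffel_form p A B W :
  \sum_i \sum_j \sum_l (partial i (fun q => neutral_metric q j l) p
     + partial j (fun q => neutral_metric q i l) p
     - partial l (fun q => neutral_metric q i j) p) * A 0 i * B 0 j * W 0 l
  = dnform p A B W + dnform p B A W - dnform p W A B.
Proof.
transitivity (\sum_i \sum_j \sum_l (dnform p (delta_mx 0 i) (delta_mx 0 j)
  (delta_mx 0 l) * A 0 i * B 0 j * W 0 l)
 + \sum_i \sum_j \sum_l (dnform p (delta_mx 0 j) (delta_mx 0 i) (delta_mx 0 l)
   * B 0 j * A 0 i * W 0 l)
 - \sum_i \sum_j \sum_l (dnform p (delta_mx 0 l) (delta_mx 0 i) (delta_mx 0 j)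
   * W 0 l * A 0 i * B 0 j)).
  rewrite -sumrN -!big_split /=; apply: eq_bigr => i _.
  rewrite -sumrN -!big_split /=; apply: eq_bigr => j _.
  rewrite -sumrN -!big_split /=; apply: eq_bigr => l _.
  by rewrite !partial_neutral_metric; ring.
congr (_ + _ - _); first exact: dnform_trilinear.
  by rewrite exchange_big; exact: dnform_trilinear.
under eq_bigr do rewrite exchange_big.
by rewrite exchange_big; exact: dnform_trilinear.
Qed.

End NeutralChristoffel.

(** * Symmetry of second derivatives *)

Section Smooth.
Context {R : realType} {m : nat}.
Implicit Types (U : set 'rV[R]_m) (f : 'rV[R]_m -> R) (u w : 'rV[R]_m).

Lemma smooth_partial U f i : smooth_on U f -> smooth_on U (partial i f).
Proof. by move=> sf n; case: (sf n.+1) => _; exact. Qed.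

Lemma smooth_differentiable U f u : smooth_on U f -> U u -> differentiable f u.
Proof. by move=> sf; case: (sf 1) => + _; exact. Qed.

Lemma smooth_continuous U f u : smooth_on U f -> U u -> {for u, continuous f}.
Proof. by move=> sf; exact: (sf 0). Qed.

Lemma smooth_is_derive U f i u : smooth_on U f -> U u ->
  is_derive u (delta_mx 0 i) f (partial i f u).
Proof. by move=> sf Uu; split=> //;
  apply/diff_derivable/(smooth_differentiable sf). Qed.

Lemma is_derive_curve f (c : R -> 'rV[R]_m) t dc :
  differentiable f (c t) -> is_derive t 1 c dc ->
  is_derive t 1 (fun s => f (c s)) ('D_dc f (c t)).
Proof.
move=> df [dct cE].
have dct' : differentiable c t by exact/derivable1_diffP.
have dfc : differentiable (f \o c) t by exact: differentiable_comp.
split; first exact/derivable1_diffP.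
rewrite deriveE// diff_comp//= [RHS]deriveE//; congr ('d f _ _).
by rewrite -deriveE.
Qed.

Lemma is_derive_line (x e : 'rV[R]_m) (t : R) : is_derive t 1 (fun s : R => x +
  s *: e) e.
Proof.
suff : is_derive t 1 (fun s : R => x + s *: e) (0 + e) by rewrite add0r.
apply: is_deriveD; split; first by apply/derivable1_diffP;
  exact: differentiableZl.
rewrite deriveE; last exact: differentiableZl.
by rewrite diffZl// diff_val /= scale1r.
Qed.

Lemma MVT_closed (f df : R -> R) (s : R) : 0 < s ->
  (forall t : R, 0 <= t <= s -> is_derive t 1 f (df t)) ->
  exists2 c, 0 <= c <= s & f s - f 0 = df c * s.
Proof.
move=> s0 fdf; have [||c + cE] := @MVT_segment R f df 0 s (ltW s0).
- by move=> t; rewrite in_itv /= => /andP[t0 ts]; apply: fdf; rewrite !ltW.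
- apply: derivable_within_continuous => t; rewrite in_itv /= => /fdf[] + _;
  exact.
- by rewrite in_itv /= => c0s; exists c; rewrite // cE subr0.
Qed.

(** The mean value theorem is used twice, along [e1] for the difference [phi] and then along [e2]
    for the derivative [psi]. The left-hand side is symmetric in [e1] and [e2], which is what
    Schwarz's theorem exploits. *)
Lemma second_difference f (e1 e2 : 'rV[R]_m) u (s : R) : 0 < s ->
  (forall a b, 0 <= a <= s -> 0 <= b <= s -> differentiable f (u + a *: e1 + b
    *: e2)) ->
  (forall a b, 0 <= a <= s -> 0 <= b <= s -> differentiable ('D_e1 f) (u + a *:
    e1 + b *: e2)) ->
  exists a b, [/\ 0 <= a <= s, 0 <= b <= s &
    f (u + s *: e1 + s *: e2) - f (u + s *: e1) - f (u + s *: e2) + f u =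
    s ^+ 2 * 'D_e2 ('D_e1 f) (u + a *: e1 + b *: e2)].
Proof.
move=> s0 df d2f; have s00 : 0 <= (0 : R) <= s by rewrite lexx ltW.
have ss : 0 <= s <= s by rewrite lexx ltW.
pose phi (t : R) := f (u + s *: e2 + t *: e1) - f (u + t *: e1).
have dphi (t : R) : 0 <= t <= s -> is_derive t 1 phi
    ('D_e1 f (u + s *: e2 + t *: e1) - 'D_e1 f (u + t *: e1)).
  move=> ts; apply: is_deriveB; apply: is_derive_curve (is_derive_line _ _ _).
    by rewrite addrAC; exact: df.
  by have := df t 0 ts s00; rewrite scale0r addr0.
have [a ai phiE] := MVT_closed s0 dphi.
pose psi (t : R) := 'D_e1 f (u + a *: e1 + t *: e2).
have dpsi (t : R) : 0 <= t <= s -> is_derive t 1 psi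
    ('D_e2 ('D_e1 f) (u + a *: e1 + t *: e2)).
  move=> ts; apply: is_derive_curve (is_derive_line _ _ _).
  exact: d2f.
have [b bi psiE] := MVT_closed s0 dpsi.
exists a, b; split=> //.
move: phiE psiE; rewrite /phi /psi !scale0r !addr0 => phiE psiE.
have -> : s ^+ 2 * 'D_e2 ('D_e1 f) (u + a *: e1 + b *: e2) =
  'D_e2 ('D_e1 f) (u + a *: e1 + b *: e2) * s * s by ring.
rewrite -psiE (addrAC u (a *: e1)) -phiE (addrAC u (s *: e1)); ring.
Qed.

Lemma smooth_near U f u (e : R) : open U -> smooth_on U f -> U u -> 0 < e ->
  exists2 s, 0 < s & forall w, `|w - u| < s -> U w /\ `|f w - f u| < e.
Proof.
move=> oU sf Uu e0.
have : \forall w \near u, U w /\ `|f w - f u| < e.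
  apply: filterI; first exact: open_nbhs_nbhs.
  have /cvgrPdist_lt /(_ e e0) := smooth_continuous sf Uu.
  by apply: filterS => w; rewrite distrC.
move=> /nbhs_ballP[s s0 H]; exists s => // w ws; apply: H.
by rewrite -ball_normE /= distrC.
Qed.

Lemma smooth_partialC U f u i j : open U -> smooth_on U f -> U u ->
  partial i (partial j f) u = partial j (partial i f) u.
Proof.
move=> oU sf Uu; apply/eqP; rewrite -subr_eq0 -normr_le0;
  apply/ler_addgt0Pl => e e0.
rewrite addr0; have e20 : 0 < e / 2 by rewrite divr_gt0.
have [s s0 Hs] := smooth_near oU (smooth_partial i (smooth_partial j sf)) Uu
  e20.
have [t t0 Ht] := smooth_near oU (smooth_partial j (smooth_partial i sf)) Uu
  e20.
(* Points of the square of side [d] at [u] are displaced by at most 2 d, which is less than both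
   radii. *)
pose d := Order.min s t / 3.
have d0 : 0 < d by rewrite divr_gt0// lt_min s0 t0.
have ne k : `|delta_mx 0 k : 'rV[R]_m| <= 1.
  rewrite /Num.Def.normr /= mx_normrE; apply: bigmax_le => // -[a b] _ /=.
  by rewrite mxE; case: (_ && _); rewrite ?normr0 ?normr1.
have close a b k l : 0 <= a <= d -> 0 <= b <= d ->
    `|u + a *: delta_mx 0 k + b *: delta_mx 0 l - u| < Order.min s t.
  move=> /andP[a0 ad] /andP[b0 bd].
  rewrite -(addrA u) (addrC u) addrK (le_lt_trans (ler_normD _ _))//.
  have: `|a *: (delta_mx 0 k : 'rV[R]_m)| <= d.
    by rewrite normrZ (ger0_norm a0) (le_trans _ ad)// ler_piMr.
  have: `|b *: (delta_mx 0 l : 'rV[R]_m)| <= d.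
    by rewrite normrZ (ger0_norm b0) (le_trans _ bd)// ler_piMr.
  by rewrite /d in d0 *; lra.
have inU a b k l : 0 <= a <= d -> 0 <= b <= d -> U (u + a *: delta_mx 0 k + b
  *: delta_mx 0 l).
  by move=> ad bd; have := close a b k l ad bd; rewrite lt_min => /andP[/Hs[]].
have sd k l := @second_difference f (delta_mx 0 k) (delta_mx 0 l) u d d0
  (fun a b ad bd => smooth_differentiable sf (inU a b k l ad bd))
  (fun a b ad bd => smooth_differentiable (smooth_partial k sf) (inU a b k l ad
    bd)).
have [a [b [ad bd ab]]] := sd i j.
have [a' [b' [a'd b'd ab']]] := sd j i.
have := close _ _ i j ad bd; rewrite lt_min => /andP[_ /Ht[_]].
have := close _ _ j i a'd b'd; rewrite lt_min => /andP[/Hs[_] + _].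
(* Both values are the same second difference divided by d^2. Each lies within e / 2 of the
   corresponding mixed derivative at [u]. *)
have -> : partial i (partial j f) (u + a' *: delta_mx 0 j + b' *: delta_mx 0 i)
   = partial j (partial i f) (u + a *: delta_mx 0 i + b *: delta_mx 0 j).
  apply: (@mulfI _ (d ^+ 2)); first by rewrite expf_neq0// gt_eqF.
  transitivity (f (u + d *: delta_mx 0 j + d *: delta_mx 0 i) - f (u + d *:
    delta_mx 0 j)
     - f (u + d *: delta_mx 0 i) + f u); first by rewrite -ab'.
  rewrite (addrAC u) [_ - f (u + d *: delta_mx 0 j) - _]addrAC; exact: ab.
move: (partial j _ _) (partial i _ _) (partial j _ _) => p q r.
rewrite !ltr_distlC => /andP[h1 h2] /andP[h3 h4].
rewrite ler_distl; clear -h1 h2 h3 h4; lra.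
Qed.

End Smooth.

(** * Infinitesimal rotational symmetry *)

Section RotationalSymmetry.
Context {R : realType}.
Local Open Scope complex_scope.

Implicit Types (z : R[i]) (u : 'rV[R]_2).

Definition ord30 : 'I_3 := @Ordinal 3 0 isT.
Definition ord31 : 'I_3 := @Ordinal 3 1 isT.
Definition ord32 : 'I_3 := @Ordinal 3 2 isT.

Lemma sum3 (f : 'I_3 -> R) : \sum_i f i = f ord30 + f ord31 + f ord32.
Proof.
rewrite !big_ord_recl big_ord0 addr0 addrA.
by congr (f _ + f _ + f _); apply: val_inj.
Qed.

Lemma ord3P (P : 'I_3 -> Prop) : P ord30 -> P ord31 -> P ord32 -> forall k, P k.
Proof.
move=> P0 P1 P2 k.
by case: k => -[|[|[|//]]] k; [move: P0|move: P1|move: P2]; congr P;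
  apply: val_inj.
Qed.

(** A left inverse of [sphere_point]. At the South pole the denominator is 0 and the value is the
    default 0. *)
Definition stereographic (w : 'cV[R]_3) : R[i] :=
  (w ord30 0 / (1 + w ord32 0)) +i* (w ord31 0 / (1 + w ord32 0)).

Lemma stereographicK (w : 'cV[R]_3) : w ord30 0 ^+ 2 + w ord31 0 ^+ 2 + w ord32
  0 ^+ 2 = 1 ->
  1 + w ord32 0 != 0 -> sphere_point (stereographic w) = w.
Proof.
move=> w1 w2.
have DE : 1 + (w ord30 0 / (1 + w ord32 0)) ^+ 2 + (w ord31 0 / (1 + w ord32
  0)) ^+ 2
   = 2 / (1 + w ord32 0).
  have -> : 2 / (1 + w ord32 0) = (w ord30 0 ^+ 2 + w ord31 0 ^+ 2 + w ord32 0
    ^+ 2 + 1 + 2 * w ord32 0) / (1 + w ord32 0) ^+ 2.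
    by rewrite w1; field.
  by field.
apply/colP; apply: ord3P; rewrite !mxE /= DE; try by field;
  rewrite ?pnatr_eq0 ?w2.
have -> : 1 - (w ord30 0 / (1 + w ord32 0)) ^+ 2 - (w ord31 0 / (1 + w ord32
  0)) ^+ 2
  = 2 - 2 / (1 + w ord32 0) by rewrite -DE; ring.
by field; rewrite ?pnatr_eq0 ?w2.
Qed.

Lemma sphere_pointE z :
  let D := conformal (complex.Re z) (complex.Im z) in
  [/\ sphere_point z ord30 0 = 2 * complex.Re z / D,
     sphere_point z ord31 0 = 2 * complex.Im z / D &
     sphere_point z ord32 0 = (1 - complex.Re z ^+ 2 - complex.Im z ^+ 2) / D].
Proof. by rewrite /= !mxE. Qed.

Lemma sphere_point_norm z : sphere_point z ord30 0 ^+ 2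
  + sphere_point z ord31 0 ^+ 2 + sphere_point z ord32 0 ^+ 2 = 1.
Proof.
have [-> -> ->] := sphere_pointE z.
have := conformal_neq0 (complex.Re z) (complex.Im z); rewrite /conformal => D0.
by field.
Qed.

Lemma sphere_point_south z : 1 + sphere_point z ord32 0 = 2 / conformal
  (complex.Re z) (complex.Im z).
Proof.
have [_ _ ->] := sphere_pointE z.
have := conformal_neq0 (complex.Re z) (complex.Im z); rewrite /conformal => D0.
by field.
Qed.

Lemma sphere_pointK z : stereographic (sphere_point z) = z.
Proof.
rewrite /stereographic sphere_point_south; have [-> -> _] := sphere_pointE z.
have := conformal_neq0 (complex.Re z) (complex.Im z); case: z => a b /= D0.
by apply/eqP; rewrite eq_complex /=; apply/andP; split; apply/eqP; field;
  rewrite ?pnatr_eq0 ?D0.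
Qed.

Definition zrot (b : R) (w : 'cV[R]_3) : 'cV[R]_3 :=
  \col_k [:: cos b * w ord30 0 - sin b * w ord31 0;
    sin b * w ord30 0 + cos b * w ord31 0; w ord32 0]`_k.

Lemma sphere_point_expi b z : sphere_point (expi b * z) = zrot b (sphere_point
  z).
Proof.
have cs := cos2Dsin2 b.
have DE : 1 + complex.Re (expi b * z) ^+ 2 + complex.Im (expi b * z) ^+ 2
  = 1 + complex.Re z ^+ 2 + complex.Im z ^+ 2.
  rewrite /expi; case: z => x y /=.
  transitivity (1 + (cos b ^+ 2 + sin b ^+ 2) * (x ^+ 2 + y ^+ 2));
    first by ring.
  by rewrite cs; ring.
apply/colP; apply: ord3P; rewrite !mxE /= DE.
- by rewrite /expi; case: z {DE} => x y /=; ring.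
- by rewrite /expi; case: z {DE} => x y /=; ring.
- congr (_ / _); move: DE; rewrite -!addrA => /addrI DE.
  by rewrite -!opprD DE.
Qed.

Lemma toC_ofC z : toC (ofC z) = z.
Proof. by rewrite /toC !mxE /=; case: z. Qed.

Lemma ofC_toC u : ofC (toC u) = u.
Proof.
apply/rowP => i; rewrite mxE /=.
by case: i => -[|[|//]] i /=; congr (u 0 _); apply: val_inj.
Qed.

Lemma derive_row2 (f : 'rV[R]_2 -> R) u w : differentiable f u ->
  'D_w f u = w 0 0 * partial 0 f u + w 0 1 * partial 1 f u.
Proof.
move=> df; rewrite /partial !deriveE// {1}(row_sum_delta w) big_ord_recl
  big_ord1.
rewrite linearD !linearZ /=; congr (_ + w 0 _ * 'd f u (delta_mx 0 _));
  exact: val_inj.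
Qed.

Lemma is_derive_row n (c : R -> 'rV[R]_n) (t : R) (dc : 'rV[R]_n) :
  (forall i, is_derive t 1 (fun s => c s 0 i) (dc 0 i)) -> is_derive t 1 c dc.
Proof.
move=> dci; have dct : derivable c t 1.
  by apply/derivable_mxP => i j; rewrite ord1; case: (dci j).
split=> //; rewrite derive_mx//; apply/rowP => j; rewrite mxE.
exact: derive_val.
Qed.

(** The symmetry is given for angles in [0, 2 pi), hence near 0 on the right only; a derivative
    known to exist is determined by its right limit. *)
Lemma derive_right_cst (f : R -> R) l : is_derive (0 : R) 1 f l ->
  (\forall t \near (0 : R)^'+, f t = f 0) -> l = 0.
Proof.
move=> [df fl] f0.
have : h^-1 *: (f (h *: 1 + 0) - f 0) @[h --> 0^'+] --> l.
  by apply: cvg_dnbhs_at_right; rewrite -fl; exact: df.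
move=> /cvg_lim <- //; apply: lim_near_cst => //.
apply: filterS f0 => t ft.
by rewrite addr0 [t *: 1]mulr1 ft subrr scaler0.
Qed.

Lemma sumsq3 (w : 'cV[R]_3) :
  w ord30 0 ^+ 2 + w ord31 0 ^+ 2 + w ord32 0 ^+ 2 = (w^T *m w) 0 0.
Proof. by rewrite mxE sum3 !mxE !expr2. Qed.

Definition zrot_generator : 'M[R]_3 := \matrix_(i, j) ((i == ord31) && (j ==
  ord30))%:R - \matrix_(i, j) ((i == ord30) && (j == ord31))%:R.

(** Rodrigues' formula. Only the scalars depend on [b], so the derivative at 0 is visibly the
    generator. *)
Lemma zrotE b (w : 'cV[R]_3) : zrot b w = 
  cos b *: w + sin b *: (zrot_generator *m w) + (1 - cos b) *: \col_k ((k ==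
    ord32)%:R * w ord32 0).
Proof. by apply/colP; apply: ord3P; rewrite !mxE sum3 !mxE /=; ring. Qed.

(** Conjugation by A turns the rotations about the third axis into a one-parameter group with
    generator [M]. The function r is constant on a short orbit arc starting at u, and its right
    derivative there is K r. *)
Lemma rotational_killing (U : set 'rV[R]_2) (r : 'rV[R]_2 -> R) (A : 'M[R]_3) :
  open U -> smooth_on U r -> A *m A^T = 1%:M ->
  (forall (beta : R) (z : R[i]) (u v : 'rV[R]_2),
    0 <= beta < 2 * pi -> U u -> U v ->
    sphere_point z = A *m sphere_point (toC u) ->
    sphere_point (expi beta * z) = A *m sphere_point (toC v) ->
    r v = r u) ->
  exists n1 n2 n3 : R, ~ [/\ n1 = 0, n2 = 0 & n3 = 0] /\
  forall u, U u -> rot_field1 n1 n2 n3 (u 0 0) (u 0 1) * partial 0 r u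
                 + rot_field2 n1 n2 n3 (u 0 0) (u 0 1) * partial 1 r u = 0.
Proof.
move=> oU sr AAT inv; have ATA : A^T *m A = 1%:M by exact: mulmx1C.
have [M ME] : exists M, M = A^T *m zrot_generator *m A by eexists.
have LT : zrot_generator^T = - zrot_generator.
  by apply/matrixP => i j;
    rewrite !mxE opprB (andbC (j == ord31)) (andbC (j == ord30)).
have MT : M^T = - M.
  by rewrite ME !trmx_mul trmxK LT mulNmx mulmxN mulmxA.
have Mij i j : M i j = - M j i by rewrite -[in LHS](trmxK M) MT !mxE.
have Mii i : M i i = 0 by have := Mij i i; lra.
(* M is antisymmetric, hence w |-> M w is the cross product with this vector. *)
exists (M ord32 ord31), (M ord30 ord32), (M ord31 ord30);
  split=> [[M21 M02 M10]|u Uu].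
  have M0 : M = 0.
    apply/matrixP; apply: ord3P; apply: ord3P; rewrite [RHS]mxE ?Mii //.
    + by rewrite Mij M10 oppr0.
    + by rewrite Mij M21 oppr0.
    + by rewrite Mij M02 oppr0.
  (* The conjugation is undone: the generator is A M A^T. *)
  have : zrot_generator = 0.
    by rewrite -[LHS]mul1mx -[LHS]mulmx1 -AAT !mulmxA -(mulmxA A) -(mulmxA A)
      -ME M0 mulmx0 mul0mx.
  move=> /matrixP/(_ ord31 ord30); rewrite !mxE /= subr0 => /eqP.
  by rewrite oner_eq0.
set x := u 0 0; set y := u 0 1.
have [s sE] : exists s, s = sphere_point (toC u) by eexists.
pose D := conformal x y.
have D0 : D != 0 := conformal_neq0 x y.
have [s0 s1 s2] : [/\ s ord30 0 = 2 * x / D, s ord31 0 = 2 * y / D & s ord32 0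
  = (1 - x ^+ 2 - y ^+ 2) / D].
  rewrite sE; exact: sphere_pointE.
have [s' s'M] : exists s', s' = M *m s by eexists.
have s'k k : s' k 0 = M k ord30 * s ord30 0 + M k ord31 * s ord31 0 + M k ord32
  * s ord32 0.
  by rewrite s'M mxE sum3.
(* [s'] is the velocity of the rotation at [s]. As 1 + s_3 = 2 / D, the differential of the
   stereographic projection sends it to (s'_1 - x s'_3, s'_2 - y s'_3) D / 2. *)
have kE1 : rot_field1 (M ord32 ord31) (M ord30 ord32) (M ord31 ord30) x y = (s'
  ord30 0 - x * s' ord32 0) * D / 2.
  rewrite !s'k !Mii (Mij ord30 ord31) (Mij ord32 ord30) s0 s1 s2 /rot_field1.
  by move: D0; rewrite /D /conformal => D0; field.
have kE2 : rot_field2 (M ord32 ord31) (M ord30 ord32) (M ord31 ord30) x y = (s'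
  ord31 0 - y * s' ord32 0) * D / 2.
  rewrite !s'k !Mii (Mij ord31 ord32) (Mij ord32 ord30) s0 s1 s2 /rot_field2.
  by move: D0; rewrite /D /conformal => D0; field.
rewrite kE1 kE2.
have [P PE] : exists P, P = A *m s by eexists.
have s'E : s' = A^T *m (zrot_generator *m P) by rewrite s'M ME PE !mulmxA.
have ATP : A^T *m P = s by rewrite PE mulmxA ATA mul1mx.
have nA (w : 'cV[R]_3) : ((A^T *m w)^T *m (A^T *m w)) 0 0 = (w^T *m w) 0 0.
  by rewrite trmx_mul trmxK -mulmxA (mulmxA A) AAT mul1mx.
have nP : P ord30 0 ^+ 2 + P ord31 0 ^+ 2 + P ord32 0 ^+ 2 = 1.
  by rewrite sumsq3 -nA ATP -sumsq3 sE sphere_point_norm.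
(* The South pole has no stereographic coordinate, but the rotation field
   vanishes there. *)
have [P2|P2] := eqVneq (1 + P ord32 0) 0.
  have P2' : P ord32 0 = -1 by lra.
  have P0 : P ord30 0 = 0 by apply/eqP; rewrite -sqrf_eq0; apply/eqP; move: nP;
    rewrite P2'; nra.
  have P1 : P ord31 0 = 0 by apply/eqP; rewrite -sqrf_eq0; apply/eqP; move: nP;
    rewrite P2' P0; nra.
  have -> : s' = 0.
    rewrite s'E (_ : zrot_generator *m P = 0) ?mulmx0//.
    by apply/colP; apply: ord3P; rewrite !mxE sum3 !mxE /= ?P0 ?P1; ring.
  by rewrite !mxE; ring.
(* [N] is the orbit of [s] and [v] its image in the chart. The invariance is applied to [z] and
   [v b]: the directions of [z] and [expi b * z] are P = A s and zrot b P = A N(b). *)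
pose N (b : R) := A^T *m zrot b P.
pose z := stereographic P; pose v (b : R) := ofC (stereographic (N b)).
have zr0 w : zrot 0 w = w.
  by apply/colP; apply: ord3P; rewrite !mxE /= ?cos0 ?sin0; ring.
have N0 : N 0 = s by rewrite /N zr0 ATP.
have v0 : v 0 = u by rewrite /v N0 sE sphere_pointK ofC_toC.
have nN b : N b ord30 0 ^+ 2 + N b ord31 0 ^+ 2 + N b ord32 0 ^+ 2 = 1.
  rewrite sumsq3 nA -sumsq3 !mxE /= -nP.
  transitivity ((cos b ^+ 2 + sin b ^+ 2) * (P ord30 0 ^+ 2 + P ord31 0 ^+ 2) +
    P ord32 0 ^+ 2); first by ring.
  by rewrite cos2Dsin2 mul1r.
have dN k : is_derive (0 : R) 1 (fun b => N b k 0) (s' k 0).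
  have dc := is_derive_cos (0 : R); have ds := is_derive_sin (0 : R).
  have E b : N b k 0 = cos b * s k 0 + sin b * s' k 0
     + (1 + - cos b) * (A^T *m (\col_k ((k == ord32)%:R * P ord32 0))) k 0.
    by rewrite /N zrotE !mulmxDr -!scalemxAr ATP -s'E !mxE.
  rewrite (funext E).
  eapply is_derive_eq; first by differentiate.
  by rewrite cos0 sin0; ring.
have s2D : 1 + s ord32 0 = 2 / D by rewrite sE sphere_point_south.
have s20 : 1 + s ord32 0 != 0 by rewrite s2D mulf_neq0 ?invr_neq0 ?pnatr_eq0.
have dv : is_derive (0 : R) 1 v (\row_k [:: (s' ord30 0 - x * s' ord32 0) * D /
  2; (s' ord31 0 - y * s' ord32 0) * D / 2]`_k).
  have dN0 := dN ord30; have dN1 := dN ord31; have dN2 := dN ord32.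
  apply: is_derive_row => -[[|[|//]] i]; rewrite mxE /=.
  - rewrite (_ : (fun b => _) = (fun b => N b ord30 0 * (1 + N b ord32 0)^-1));
    last first.
      by apply/funext => b; rewrite mxE.
    eapply is_derive_eq; first by differentiate; rewrite N0.
    by rewrite /= N0 s2D s0; field.
  - rewrite (_ : (fun b => _) = (fun b => N b ord31 0 * (1 + N b ord32 0)^-1));
    last first.
      by apply/funext => b; rewrite mxE.
    eapply is_derive_eq; first by differentiate; rewrite N0.
    by rewrite /= N0 s2D s1; field.
have dr : differentiable r (v 0) by rewrite v0;
  exact: smooth_differentiable sr Uu.
have := derive_right_cst (is_derive_curve dr dv).
rewrite derive_row2// v0 !mxE /=; apply.
(* The orbit may leave [U] or meet the South pole later on; for small [b] it does neither. *)
have vU : \forall b \near (0 : R), U (v b).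
  have /derivable1_diffP/differentiable_continuous cv : derivable v 0 1 by [].
  by apply: cv; rewrite /= v0; exact: open_nbhs_nbhs.
have N2 : \forall b \near (0 : R), 1 + N b ord32 0 != 0.
  have dN2 := dN ord32.
  have /derivable1_diffP/differentiable_continuous cN :
    derivable (fun b => 1 + N b ord32 0) 0 1 by eapply ex_derive; differentiate.
  by apply: (cvgr_neq0 _ cN); rewrite N0.
near=> b.
apply: (inv b z u (v b)).
- apply/andP; split; first by near: b; exact: nbhs_right_ge.
  by near: b; apply: nbhs_right_lt; rewrite mulr_gt0// pi_gt0.
- by [].
- by near: b; exact: cvg_within vU.
- by rewrite stereographicK// PE sE.
- rewrite sphere_point_expi stereographicK// toC_ofC stereographicK//;
  last first.
    by near: b; exact: cvg_within N2.
  by rewrite /N mulmxA AAT mul1mx.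
Unshelve. all: by end_near.
Qed.

End RotationalSymmetry.

(** * Tangent and normal frames of a Lagrangian section *)

(** By Cayley-Hamilton the square of a traceless 2 x 2 matrix is scalar, so the inverse is
    proportional to [h]. Hence one quadratic form serves both for vectors such as K and for
    covectors such as N. *)
Lemma invmx_traceless {R : realFieldType} (h : 'M[R]_2) (s t : R) : h \in
  unitmx ->
  h 0 0 = - s -> h 0 1 = t / 2 -> h 1 0 = t / 2 -> h 1 1 = s ->
  s ^+ 2 + t ^+ 2 / 4 != 0 /\ invmx h = (s ^+ 2 + t ^+ 2 / 4)^-1 *: h.
Proof.
move=> hu h00 h01 h10 h11; pose d := s ^+ 2 + t ^+ 2 / 4.
have hh : h *m h = d%:M.
  have l1 : lift ord0 ord0 = 1 :> 'I_2 by exact: val_inj.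
  have l0 : ord0 = 0 :> 'I_2 by exact: val_inj.
  by apply/matrixP; elim/ord2P; elim/ord2P;
    rewrite !mxE !big_ord_recl big_ord0 addr0 l1 l0 ?h00 ?h01 ?h10 ?h11 /d /=;
      field.
have d0 : d != 0.
  have : h *m h \in unitmx by rewrite unitmx_mul hu.
  by rewrite hh unitmxE det_scalar unitrX_pos// unitfE.
split=> //; rewrite -[LHS]mulmx1 -[1%:M](@scalerK _ _ d)//.
by rewrite scalemx1 -hh -scalemxAr mulKmx.
Qed.

Definition coords {R : realType} (V : 'rV[R]_(2 + 2)) (a b c d : R) : Prop :=
  [/\ V 0 ix = a, V 0 iy = b, V 0 ia = c & V 0 ib = d].

Section TangentFrame.
Context {R : realType}.
Implicit Types V : 'rV[R]_(2 + 2).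

(* The complex structure of the tangent bundle of the sphere: multiplication of
   (xi, eta) by i. It is an isometry of the neutral metric and, the section
   being Lagrangian, maps its tangent planes to its normal planes. *)
Definition Jmul V : 'rV[R]_(2 + 2) :=
  \row_k (if k == ix then - V 0 iy else if k == iy then V 0 ix
          else if k == ia then - V 0 ib else V 0 ia).

Lemma Jmul_coords V a b c d : coords V a b c d -> coords (Jmul V) (- b) a (- d)
  c.
Proof. by case=> <- <- <- <-; split; rewrite mxE. Qed.

Variables (x y r1 r2 r11 r12 r22 r111 r112 r122 r222 : R).
Let D := conformal x y.
Local Notation S := (jetS x y r1 r2 r12).
Local Notation T := (jetT x y r1 r2 r11 r22).
Local Notation C0 := (jetC0 x y r1 r2 r11 r12 r111).
Local Notation C1 := (jetC1 x y r1 r2 r11 r12 r22 r112).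
Local Notation C2 := (jetC2 x y r1 r2 r11 r12 r22 r122).
Local Notation C3 := (jetC3 x y r1 r2 r12 r22 r222).

(** The point of the section, its tangent frame and the second derivatives of the immersion, known
    only by their coordinates, so that what follows is rational algebra. The factor D^2 / 4 combines
    D^2 / 2 in the formula for F with the 1/2 of the Wirtinger derivative. *)
Variables (p E0 E1 A00 A01 A10 A11 : 'rV[R]_(2 + 2)).
Let w := D ^+ 2 / 4.
Hypothesis pE : coords p x y (w * r1) (w * r2).
Hypothesis E0E : coords E0 1 0 (D * x * r1 + w * r11) (D * x * r2 + w * r12).
Hypothesis E1E : coords E1 0 1 (D * y * r1 + w * r12) (D * y * r2 + w * r22).
Hypothesis A00E : coords A00 0 0
  ((2 * x ^+ 2 + D) * r1 + 2 * D * x * r11 + w * r111)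
  ((2 * x ^+ 2 + D) * r2 + 2 * D * x * r12 + w * r112).
Hypothesis A01E : coords A01 0 0
  (2 * x * y * r1 + D * y * r11 + D * x * r12 + w * r112)
  (2 * x * y * r2 + D * y * r12 + D * x * r22 + w * r122).
Hypothesis A10E : coords A10 0 0
  (2 * x * y * r1 + D * y * r11 + D * x * r12 + w * r112)
  (2 * x * y * r2 + D * y * r12 + D * x * r22 + w * r122).
Hypothesis A11E : coords A11 0 0
  ((2 * y ^+ 2 + D) * r1 + 2 * D * y * r12 + w * r122)
  ((2 * y ^+ 2 + D) * r2 + 2 * D * y * r22 + w * r222).

Lemma conformal_ptE : conformal_pt p = D.
Proof. by rewrite /conformal_pt; have [-> -> _ _] := pE. Qed.

Lemma induced_coord :
  [/\ nform p E0 E0 = - S, nform p E0 E1 = T / 2,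
      nform p E1 E0 = T / 2 & nform p E1 E1 = S].
Proof.
have D0 : D != 0 := conformal_neq0 x y.
rewrite /nform conformal_ptE; have [-> -> -> ->] := pE.
have [-> -> -> ->] := E0E.
have [-> -> -> ->] := E1E.
rewrite /jetS /jetT -/D /w; move: D D0 => d d0.
by split; field.
Qed.

(* G(nabla_B C, J V), where A is the second derivative of the immersion and
   dnform gives the Christoffel symbols of the first kind. *)
Definition cubic A B C V :=
  nform p A (Jmul V) + 2^-1 * (dnform p B C (Jmul V)
   + dnform p C B (Jmul V) - dnform p (Jmul V) B C).

(** Eight components reduce to four: the first two slots commute because the connection has no
    torsion, the last two because J is parallel and G(e_b, J e_c) = 0. *)
Lemma cubicE : [/\ cubic A00 E0 E0 E0 = C0, cubic A11 E1 E1 E1 = C3,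
  [/\ cubic A00 E0 E0 E1 = C1, cubic A01 E0 E1 E0 = C1
    & cubic A10 E1 E0 E0 = C1] &
  [/\ cubic A01 E0 E1 E1 = C2, cubic A10 E1 E0 E1 = C2
    & cubic A11 E1 E1 E0 = C2]].
Proof.
have D0 : D != 0 := conformal_neq0 x y.
have DE : D = 1 + x ^+ 2 + y ^+ 2 by [].
rewrite /cubic /nform /dnform conformal_ptE; have [-> -> -> ->] := pE.
have [-> -> -> ->] := Jmul_coords E0E.
have [-> -> -> ->] := Jmul_coords E1E.
have [-> -> -> ->] := E0E.
have [-> -> -> ->] := E1E.
have [-> -> -> ->] := A00E.
have [-> -> -> ->] := A01E.
have [-> -> -> ->] := A10E.
have [-> -> -> ->] := A11E.
rewrite /jetC0 /jetC1 /jetC2 /jetC3 -/D /w.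
(* Written this way the identities hold for a free variable D, which is generalised before
   [field]. *)
have -> : 1 + x ^+ 2 - y ^+ 2 = D - 2 * y ^+ 2 by rewrite DE; ring.
have -> : 1 - x ^+ 2 + y ^+ 2 = D - 2 * x ^+ 2 by rewrite DE; ring.
have -> : 1 + 3 * x ^+ 2 - 3 * y ^+ 2 = D + 2 * x ^+ 2 - 4 * y ^+ 2.
  by rewrite DE; ring.
have -> : 1 - 3 * x ^+ 2 + 3 * y ^+ 2 = D - 4 * x ^+ 2 + 2 * y ^+ 2.
  by rewrite DE; ring.
clear DE; move: D D0 => d d0.
by split; [| |split|split]; field.
Qed.

(* E0, E1, J E0, J E1 is a frame whose Gram matrix has two diagonal blocks, both
   equal to the induced metric. *)
Lemma gram V :
  nform p V V * (S ^+ 2 + T ^+ 2 / 4) =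
  (- S * nform p V E0 ^+ 2 + T * nform p V E0 * nform p V E1
     + S * nform p V E1 ^+ 2)
  + (- S * nform p V (Jmul E0) ^+ 2
     + T * nform p V (Jmul E0) * nform p V (Jmul E1) + S * nform p V (Jmul E1)
       ^+ 2).
Proof.
have D0 : D != 0 := conformal_neq0 x y.
rewrite /nform conformal_ptE; have [-> -> -> ->] := pE.
have [-> -> -> ->] := Jmul_coords E0E.
have [-> -> -> ->] := Jmul_coords E1E.
have [-> -> -> ->] := E0E.
have [-> -> -> ->] := E1E.
rewrite /jetS /jetT -/D /w; move: D D0 => d d0.
move: (V 0 ix) (V 0 iy) (V 0 ia) (V 0 ib) => Vx Vy Va Vb.
by field.
Qed.

Lemma nform_orth (c0 c1 : R) V :
  nform p (V - (c0 *: E0 + c1 *: E1)) (V - (c0 *: E0 + c1 *: E1)) =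
  nform p V V - 2 * (c0 * nform p V E0 + c1 * nform p V E1)
  + c0 ^+ 2 * nform p E0 E0 + 2 * c0 * c1 * nform p E0 E1 + c1 ^+ 2 * nform p
    E1 E1.
Proof. by rewrite /nform !mxE; ring. Qed.

End TangentFrame.

Section NormalProjection.
Context {R : realType}.
Variables (p : 'rV[R]_(2 + 2)) (E : 'I_2 -> 'rV[R]_(2 + 2)) (h : 'M[R]_2) (s t
  : R).
Hypothesis hE : forall a b, h a b = nform p (E a) (E b).
Hypotheses (h00 : nform p (E 0) (E 0) = - s) (h01 : nform p (E 0) (E 1) = t / 2)
  (h10 : nform p (E 1) (E 0) = t / 2) (h11 : nform p (E 1) (E 1) = s).
Let d := s ^+ 2 + t ^+ 2 / 4.
Hypotheses (d0 : d != 0) (hi : invmx h = d^-1 *: h).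

Let mE a b : (d^-1 *: h) a b = d^-1 * nform p (E a) (E b).
Proof. by rewrite mxE hE. Qed.

Lemma trace_nform (W : 'I_2 -> 'I_2 -> 'rV[R]_(2 + 2)) Z :
  nform p (\sum_a \sum_b invmx h a b *: W a b) Z =
  d^-1 * (- s * (nform p (W 0 0) Z - nform p (W 1 1) Z)
          + t / 2 * (nform p (W 0 1) Z + nform p (W 1 0) Z)).
Proof.
rewrite !sum2 -!metric_neutral !metricDl !metricZl hi !metric_neutral.
rewrite !mE h00 h01 h10 h11; ring.
Qed.

(** Pythagoras: the term subtracted is the tangential half of [gram] divided by [d], so only the
    components along J E_0 and J E_1 will remain. *)
Lemma nform_orthogonal V :
  let H := V - \sum_a \sum_b (invmx h a b * nform p V (E a)) *: E b in
  nform p H H = nform p V V - (- s * nform p V (E 0) ^+ 2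
    + t * nform p V (E 0) * nform p V (E 1) + s * nform p V (E 1) ^+ 2) / d.
Proof.
set V0 := nform p V (E 0); set V1 := nform p V (E 1).
have -> : \sum_a \sum_b (invmx h a b * nform p V (E a)) *: E b =
    (d^-1 * (- s * V0 + t / 2 * V1)) *: E 0 + (d^-1 * (t / 2 * V0 + s * V1)) *:
      E 1.
  rewrite !sum2 hi !mE h00 h01 h10 h11.
  rewrite -/V0 -/V1 addrACA -!scalerDl; congr (_ *: _ + _ *: _); ring.
rewrite /= nform_orth -/V0 -/V1 h00 h01 h11 /d; field.
by rewrite (_ : s ^+ 2 * 4 + t ^+ 2 = d * 4) ?mulf_neq0 ?pnatr_eq0// /d; field.
Qed.

End NormalProjection.

(** * Derivatives of the section and of its support function *)

Section Jets.
Context {R : realType}.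
Variables (U : set 'rV[R]_2) (r : 'rV[R]_2 -> R).
Hypotheses (oU : open U) (sr : smooth_on U r).
Implicit Types u v : 'rV[R]_2.

Lemma partial_eq_on (f g : 'rV[R]_2 -> R) i u :
  (forall v, U v -> f v = g v) -> U u -> partial i f u = partial i g u.
Proof.
move=> fg Uu; apply: near_eq_derive.
by apply: filterS (open_nbhs_nbhs (conj oU Uu)) => v; exact: fg.
Qed.

Lemma partial_smooth3 i j k u : U u ->
  [/\ partial i (partial j (partial k r)) u = partial j (partial i (partial k
    r)) u &
     partial i (partial j (partial k r)) u = partial i (partial k (partial j
       r)) u].
Proof.
move=> Uu; split.
  by apply: (smooth_partialC _ _ oU) => //; exact: smooth_partial.
by apply: partial_eq_on Uu => v Uv; exact: (smooth_partialC _ _ oU).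
Qed.

Let conformal2 v := conformal (v 0 0) (v 0 1).

(** For [c] = 0 and 1, the real and imaginary parts of a section with support function [r]. *)
Definition potential c v := conformal2 v ^+ 2 / 4 * partial c r v.
Definition dpotential a c v :=
  conformal2 v * v 0 a * partial c r v + conformal2 v ^+ 2 / 4 * partial a
    (partial c r) v.
Definition ddpotential b a c v :=
  (2 * v 0 b * v 0 a + conformal2 v * (a == b)%:R) * partial c r v
  + conformal2 v * v 0 a * partial b (partial c r) v
  + conformal2 v * v 0 b * partial a (partial c r) v
  + conformal2 v ^+ 2 / 4 * partial b (partial a (partial c r)) v.

Lemma partial_potential a c v : U v -> partial a (potential c) v = dpotential a
  c v.
Proof.
move=> Uv; have dr := smooth_is_derive a (smooth_partial c sr) Uv.
suff [_ <-] : is_derive v (delta_mx 0 a) (potential c) (dpotential a c v) by [].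
eapply is_derive_eq; first by rewrite /potential /conformal2 /conformal;
  differentiate.
rewrite /dpotential /conformal2 /conformal.
move: (partial a (partial c r) v) (partial c r v) => p q.
by elim/ord2P: a {dr}; rewrite !mxE /=; move: (v 0 0) (v 0 1) => x y; field.
Qed.

Lemma partial_dpotential b a c v : U v -> partial b (dpotential a c) v =
  ddpotential b a c v.
Proof.
move=> Uv; have dr := smooth_is_derive b (smooth_partial c sr) Uv.
have ddr := smooth_is_derive b (smooth_partial a (smooth_partial c sr)) Uv.
suff [_ <-] : is_derive v (delta_mx 0 b) (dpotential a c) (ddpotential b a c v)
  by [].
eapply is_derive_eq; first by rewrite /dpotential /conformal2 /conformal;
  differentiate.
rewrite /ddpotential /conformal2 /conformal.
move: (partial b (partial a (partial c r)) v) (partial b (partial c r) v) => p1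
  p2.
move: (partial a (partial c r) v) (partial c r v) => p3 p4.
by elim/ord2P: a {ddr}; elim/ord2P: b {dr}; rewrite !mxE /=;
  move: (v 0 0) (v 0 1) => x y; field.
Qed.

Variable F : 'rV[R]_2 -> R[i].
Hypothesis FE : forall v, U v ->
  complex.Re (F v) = potential 0 v /\ complex.Im (F v) = potential 1 v.

Lemma graph_coord v :
  coords (graph F v) (v 0 0) (v 0 1) (complex.Re (F v)) (complex.Im (F v)).
Proof. by split; rewrite /graph ?row_mxEl ?row_mxEr// mxE. Qed.

Lemma partial_coord (i j : 'I_2) v : partial i (fun w : 'rV[R]_2 => w 0 j) v =
  (i == j)%:R.
Proof.
have [_ E] := is_derive_coord j v (delta_mx 0 i).
by rewrite /partial E mxE eqxx eq_sym.
Qed.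

Lemma tangent_coord a v : U v -> coords (tangent (graph F) a v)
  (a == 0)%:R (a == 1)%:R (dpotential a 0 v) (dpotential a 1 v).
Proof.
move=> Uv; split; rewrite mxE.
- rewrite -(partial_coord _ _ v); congr (partial a _ v).
  by apply/funext => w; case: (graph_coord w).
- rewrite -(partial_coord _ _ v); congr (partial a _ v).
  by apply/funext => w; case: (graph_coord w).
- rewrite -partial_potential//; apply: partial_eq_on => // w Uw.
  by have [_ _ -> _] := graph_coord w; case: (FE Uw).
- rewrite -partial_potential//; apply: partial_eq_on => // w Uw.
  by have [_ _ _ ->] := graph_coord w; case: (FE Uw).
Qed.

Definition acceleration b a v : 'rV[R]_(2 + 2) :=
  \row_k partial b (fun w => tangent (graph F) a w 0 k) v.

Lemma partial_cst (i : 'I_2) (c : R) v : partial i (fun=> c) v = 0.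
Proof. by have [_] := is_derive_fun_cst c v (delta_mx 0 i). Qed.

Lemma acceleration_coord b a v : U v ->
  coords (acceleration b a v) 0 0 (ddpotential b a 0 v) (ddpotential b a 1 v).
Proof.
move=> Uv; split; rewrite mxE.
- rewrite -[RHS](partial_cst b (a == 0)%:R v); apply: partial_eq_on => // w Uw.
  by case: (tangent_coord a Uw).
- rewrite -[RHS](partial_cst b (a == 1)%:R v); apply: partial_eq_on => // w Uw.
  by case: (tangent_coord a Uw).
- rewrite -partial_dpotential//; apply: partial_eq_on => // w Uw.
  by case: (tangent_coord a Uw).
- rewrite -partial_dpotential//; apply: partial_eq_on => // w Uw.
  by case: (tangent_coord a Uw).
Qed.

(** Derivatives of [r] at a point become variables; the symmetry relations among them are then
    equations that [subst] eliminates. *)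
Ltac gen_jets := repeat match goal with
  |- context [partial ?i ?f ?v] => generalize (partial i f v) end.

Section Point.
Variables (u : 'rV[R]_2) (Uu : U u).

Local Notation x := (u 0 0).
Local Notation y := (u 0 1).
Local Notation r1 := (partial 0 r u).
Local Notation r2 := (partial 1 r u).
Local Notation r11 := (partial 0 (partial 0 r) u).
Local Notation r12 := (partial 0 (partial 1 r) u).
Local Notation r22 := (partial 1 (partial 1 r) u).
Local Notation r111 := (partial 0 (partial 0 (partial 0 r)) u).
Local Notation r112 := (partial 0 (partial 0 (partial 1 r)) u).
Local Notation r122 := (partial 0 (partial 1 (partial 1 r)) u).
Local Notation r222 := (partial 1 (partial 1 (partial 1 r)) u).
Local Notation D := (conformal x y).
Local Notation w := (D ^+ 2 / 4).
Local Notation E0 := (tangent (graph F) 0 u).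
Local Notation E1 := (tangent (graph F) 1 u).

(** This and the next lemmas put mixed derivatives in a normal form, with indices increasing from
    the outermost to the innermost. *)
Lemma partial10 : partial 1 (partial 0 r) u = r12.
Proof. exact (smooth_partialC 1 0 oU sr Uu). Qed.
Lemma partial010 : partial 0 (partial 1 (partial 0 r)) u = r112.
Proof. exact ((proj2 (partial_smooth3 0 1 0 Uu))). Qed.
Lemma partial100 : partial 1 (partial 0 (partial 0 r)) u = r112.
Proof. exact (etrans (proj1 (partial_smooth3 1 0 0 Uu)) partial010). Qed.
Lemma partial101 : partial 1 (partial 0 (partial 1 r)) u = r122.
Proof. exact ((proj1 (partial_smooth3 1 0 1 Uu))). Qed.
Lemma partial110 : partial 1 (partial 1 (partial 0 r)) u = r122.
Proof. exact (etrans (proj2 (partial_smooth3 1 1 0 Uu)) partial101). Qed.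

Lemma point_coords : coords (graph F u) x y (w * r1) (w * r2).
Proof. by have := graph_coord u; have [-> ->] := FE Uu. Qed.

Lemma E0_coords : coords E0 1 0 (D * x * r1 + w * r11) (D * x * r2 + w * r12).
Proof. by rewrite /coords; have [-> -> -> ->] := tangent_coord 0 Uu; split. Qed.

Lemma E1_coords : coords E1 0 1 (D * y * r1 + w * r12) (D * y * r2 + w * r22).
Proof. by rewrite /coords; have [-> -> -> ->] := tangent_coord 1 Uu; split;
  [| |by rewrite /dpotential partial10|by rewrite /dpotential]. Qed.

Lemma A00_coords : coords (acceleration 0 0 u) 0 0
  ((2 * x ^+ 2 + D) * r1 + 2 * D * x * r11 + w * r111)
  ((2 * x ^+ 2 + D) * r2 + 2 * D * x * r12 + w * r112).
Proof.
rewrite /coords; have [-> -> -> ->] := acceleration_coord 0 0 Uu; split;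
  [by []|by []| |];
  rewrite /ddpotential /conformal2 /=;
    move: partial010 partial100 partial101 partial110 partial10;
  gen_jets; intros; subst; ring.
Qed.

Lemma A01_coords : coords (acceleration 0 1 u) 0 0
  (2 * x * y * r1 + D * y * r11 + D * x * r12 + w * r112)
  (2 * x * y * r2 + D * y * r12 + D * x * r22 + w * r122).
Proof.
rewrite /coords; have [-> -> -> ->] := acceleration_coord 0 1 Uu; split;
  [by []|by []| |];
  rewrite /ddpotential /conformal2 /=;
    move: partial010 partial100 partial101 partial110 partial10;
  gen_jets; intros; subst; ring.
Qed.

Lemma A10_coords : coords (acceleration 1 0 u) 0 0
  (2 * x * y * r1 + D * y * r11 + D * x * r12 + w * r112)
  (2 * x * y * r2 + D * y * r12 + D * x * r22 + w * r122).
Proof.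
rewrite /coords; have [-> -> -> ->] := acceleration_coord 1 0 Uu; split;
  [by []|by []| |];
  rewrite /ddpotential /conformal2 /=;
    move: partial010 partial100 partial101 partial110 partial10;
  gen_jets; intros; subst; ring.
Qed.

Lemma A11_coords : coords (acceleration 1 1 u) 0 0
  ((2 * y ^+ 2 + D) * r1 + 2 * D * y * r12 + w * r122)
  ((2 * y ^+ 2 + D) * r2 + 2 * D * y * r22 + w * r222).
Proof.
rewrite /coords; have [-> -> -> ->] := acceleration_coord 1 1 Uu; split;
  [by []|by []| |];
  rewrite /ddpotential /conformal2 /=;
    move: partial010 partial100 partial101 partial110 partial10;
  gen_jets; intros; subst; ring.
Qed.

End Point.

Lemma derive_eq0 (f : 'rV[R]_2 -> R) i v d : (forall w, U w -> f w = 0) -> U v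
  ->
  is_derive v (delta_mx 0 i) f d -> d = 0.
Proof.
move=> f0 Uv [_ <-]; rewrite -[RHS](partial_cst i 0 v).
exact: partial_eq_on.
Qed.

(** * The Killing equation and its derivatives *)

Section Killing.
Variables n1 n2 n3 : R.
Local Notation k1 v := (rot_field1 n1 n2 n3 (v 0 0) (v 0 1)).
Local Notation k2 v := (rot_field2 n1 n2 n3 (v 0 0) (v 0 1)).
(** [dk1] and [dk2] are the x- and y-derivatives of [k1]. Those of [k2] are - [dk2] and [dk1] by the
    Cauchy-Riemann equations, K being conformal. *)
Local Notation dk1 v := (n2 * v 0 0 - n1 * v 0 1).
Local Notation dk2 v := (- n3 - n1 * v 0 0 - n2 * v 0 1).
Hypothesis kr : forall v, U v -> k1 v * partial 0 r v + k2 v * partial 1 r v =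
  0.

Lemma killing_d0 v : U v -> k1 v * partial 0 (partial 0 r) v + k2 v * partial 0
  (partial 1 r) v
  + (dk1 v * partial 0 r v - dk2 v * partial 1 r v) = 0.
Proof.
move=> Uv.
have d1 := smooth_is_derive 0 (smooth_partial 0 sr) Uv.
have d2 := smooth_is_derive 0 (smooth_partial 1 sr) Uv.
apply: (derive_eq0 (i := 0) kr Uv); move: d1 d2; clear.
generalize (partial 0 r) (partial 1 r) => f0 f1.
gen_jets; move=> *.
eapply is_derive_eq; first by rewrite /rot_field1 /rot_field2; differentiate.
by rewrite /rot_field1 /rot_field2 !mxE /=; move: (v 0 0) (v 0 1) => x y; field.
Qed.

Lemma killing_d1 v : U v -> k1 v * partial 1 (partial 0 r) v + k2 v * partial 1
  (partial 1 r) v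
  + (dk2 v * partial 0 r v + dk1 v * partial 1 r v) = 0.
Proof.
move=> Uv.
have d1 := smooth_is_derive 1 (smooth_partial 0 sr) Uv.
have d2 := smooth_is_derive 1 (smooth_partial 1 sr) Uv.
apply: (derive_eq0 (i := 1) kr Uv); move: d1 d2; clear.
generalize (partial 0 r) (partial 1 r) => f0 f1.
gen_jets; move=> *.
eapply is_derive_eq; first by rewrite /rot_field1 /rot_field2; differentiate.
by rewrite /rot_field1 /rot_field2 !mxE /=; move: (v 0 0) (v 0 1) => x y; field.
Qed.

Lemma killing_d00 v : U v -> k1 v * partial 0 (partial 0 (partial 0 r)) v
  + k2 v * partial 0 (partial 0 (partial 1 r)) v
  + 2 * (dk1 v * partial 0 (partial 0 r) v - dk2 v * partial 0 (partial 1 r) v)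
  + n2 * partial 0 r v + n1 * partial 1 r v = 0.
Proof.
move=> Uv.
have d1 := smooth_is_derive 0 (smooth_partial 0 sr) Uv.
have d2 := smooth_is_derive 0 (smooth_partial 1 sr) Uv.
have d3 := smooth_is_derive 0 (smooth_partial 0 (smooth_partial 0 sr)) Uv.
have d4 := smooth_is_derive 0 (smooth_partial 0 (smooth_partial 1 sr)) Uv.
apply: (derive_eq0 (i := 0) killing_d0 Uv); move: d1 d2 d3 d4; clear.
(* The second derivatives are made opaque before the first ones, which occur inside them. *)
generalize (partial 0 (partial 0 r)) (partial 0 (partial 1 r)) => f2 f3.
generalize (partial 0 r) (partial 1 r) => f0 f1.
gen_jets; move=> *.
eapply is_derive_eq; first by rewrite /rot_field1 /rot_field2; differentiate.
by rewrite /rot_field1 /rot_field2 !mxE /=; move: (v 0 0) (v 0 1) => x y; field.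
Qed.

Lemma killing_d01 v : U v -> k1 v * partial 0 (partial 1 (partial 0 r)) v
  + k2 v * partial 0 (partial 1 (partial 1 r)) v
  + (dk1 v * partial 1 (partial 0 r) v - dk2 v * partial 1 (partial 1 r) v)
  + (dk2 v * partial 0 (partial 0 r) v + dk1 v * partial 0 (partial 1 r) v)
  + (- n1 * partial 0 r v + n2 * partial 1 r v) = 0.
Proof.
move=> Uv.
have d1 := smooth_is_derive 0 (smooth_partial 0 sr) Uv.
have d2 := smooth_is_derive 0 (smooth_partial 1 sr) Uv.
have d3 := smooth_is_derive 0 (smooth_partial 1 (smooth_partial 0 sr)) Uv.
have d4 := smooth_is_derive 0 (smooth_partial 1 (smooth_partial 1 sr)) Uv.
apply: (derive_eq0 (i := 0) killing_d1 Uv); move: d1 d2 d3 d4; clear.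
generalize (partial 1 (partial 0 r)) (partial 1 (partial 1 r)) => f2 f3.
generalize (partial 0 r) (partial 1 r) => f0 f1.
gen_jets; move=> *.
eapply is_derive_eq; first by rewrite /rot_field1 /rot_field2; differentiate.
by rewrite /rot_field1 /rot_field2 !mxE /=; move: (v 0 0) (v 0 1) => x y; field.
Qed.

Lemma killing_d11 v : U v -> k1 v * partial 1 (partial 1 (partial 0 r)) v
  + k2 v * partial 1 (partial 1 (partial 1 r)) v
  + 2 * (dk2 v * partial 1 (partial 0 r) v + dk1 v * partial 1 (partial 1 r) v)
  + (- n2 * partial 0 r v - n1 * partial 1 r v) = 0.
Proof.
move=> Uv.
have d1 := smooth_is_derive 1 (smooth_partial 0 sr) Uv.
have d2 := smooth_is_derive 1 (smooth_partial 1 sr) Uv.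
have d3 := smooth_is_derive 1 (smooth_partial 1 (smooth_partial 0 sr)) Uv.
have d4 := smooth_is_derive 1 (smooth_partial 1 (smooth_partial 1 sr)) Uv.
apply: (derive_eq0 (i := 1) killing_d1 Uv); move: d1 d2 d3 d4; clear.
generalize (partial 1 (partial 0 r)) (partial 1 (partial 1 r)) => f2 f3.
generalize (partial 0 r) (partial 1 r) => f0 f1.
gen_jets; move=> *.
eapply is_derive_eq; first by rewrite /rot_field1 /rot_field2; differentiate.
by rewrite /rot_field1 /rot_field2 !mxE /=; move: (v 0 0) (v 0 1) => x y; field.
Qed.

Lemma covariant_Jmul a b c u : U u ->
  nform (graph F u) (covariant neutral_metric (graph F) b c u) (Jmul (tangent
    (graph F) a u)) =
  cubic (graph F u) (acceleration b c u) (tangent (graph F) b u)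
    (tangent (graph F) c u) (tangent (graph F) a u).
Proof.
move=> Uu; rewrite -metric_neutral metric_covariant ?neutral_metric_sym
  ?neutral_metric_unit//.
by rewrite christoffel_form metric_neutral.
Qed.

Hypothesis n0 : ~ [/\ n1 = 0, n2 = 0 & n3 = 0].

Lemma mean_curvature_null u : U u ->
  induced_metric neutral_metric (graph F) u \in unitmx ->
  metric neutral_metric (graph F u) (mean_curvature neutral_metric (graph F) u)
    (mean_curvature neutral_metric (graph F) u) = 0.
Proof.
move=> Uu hu.
have PC := point_coords Uu; have E0C := E0_coords Uu; have E1C := E1_coords Uu.
have [I00 I01 I10 I11] := induced_coord PC E0C E1C.
have [C0 C3 [C1 C1' C1''] [C2 C2' C2'']] := cubicE PC E0C E1C (A00_coords Uu)
  (A01_coords Uu) (A10_coords Uu) (A11_coords Uu).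
have G := gram PC E0C E1C.
have hE a b : induced_metric neutral_metric (graph F) u a b =
    nform (graph F u) (tangent (graph F) a u) (tangent (graph F) b u).
  by rewrite mxE metric_neutral.
have [d0 hi] := invmx_traceless hu (etrans (hE _ _) I00) (etrans (hE _ _) I01)
  (etrans (hE _ _) I10) (etrans (hE _ _) I11).
rewrite metric_neutral mean_curvatureE.
have nE V : normal_part neutral_metric (graph F) u V = V - \sum_a \sum_b
    (invmx (induced_metric neutral_metric (graph F) u) a b
     * nform (graph F u) V (tangent (graph F) a u)) *: tangent (graph F) b u.
  congr (_ - _); apply: eq_bigr => a _; apply: eq_bigr => b _.
  by rewrite metric_neutral.
rewrite nE (nform_orthogonal hE I00 I01 I10 I11 d0 hi).
set V := \sum_a _.
(* After multiplication by d, [gram] splits G(V, V), and its tangential half cancels against the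
   projection. *)
apply/eqP; rewrite subr_eq0 -(inj_eq (mulIf d0)) G divfK// addrC -subr_eq0
  addrK; apply/eqP.
have VJ Z := trace_nform hE I00 I01 I10 I11 hi (fun a b => covariant
  neutral_metric (graph F) a b u) Z.
have trace_eq N (c d s w00 w01 w10 w11 c00 c01 c10 c11 : R) :
    N = d^-1 * (s * (w00 - w11) + c * (w01 + w10)) ->
    w00 = c00 -> w11 = c11 -> w01 = c01 -> w10 = c10 ->
    N = d^-1 * (s * (c00 - c11) + c * (c01 + c10)) by move=> -> -> -> -> ->.
have e2 : k1 u * partial 0 (partial 1 r) u + k2 u * partial 1 (partial 1 r) u
    + (dk2 u * partial 0 r u + dk1 u * partial 1 r u) = 0.
  by move: (killing_d1 Uu) (partial10 Uu); gen_jets; intros; subst.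
have f2 : k1 u * partial 0 (partial 0 (partial 1 r)) u
  + k2 u * partial 0 (partial 1 (partial 1 r)) u
  + (dk1 u * partial 0 (partial 1 r) u - dk2 u * partial 1 (partial 1 r) u)
  + (dk2 u * partial 0 (partial 0 r) u + dk1 u * partial 0 (partial 1 r) u)
  + (- n1 * partial 0 r u + n2 * partial 1 r u) = 0.
  by move: (killing_d01 Uu) (partial10 Uu) (partial010 Uu); gen_jets; intros;
    subst.
have f3 : k1 u * partial 0 (partial 1 (partial 1 r)) u
  + k2 u * partial 1 (partial 1 (partial 1 r)) u
  + 2 * (dk2 u * partial 0 (partial 1 r) u + dk1 u * partial 1 (partial 1 r) u)
  + (- n2 * partial 0 r u - n1 * partial 1 r u) = 0.
  by move: (killing_d11 Uu) (partial10 Uu) (partial110 Uu); gen_jets; intros;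
    subst.
have kj : killing_jet (partial 0 r u) (partial 1 r u) (partial 0 (partial 0 r)
  u)
    (partial 0 (partial 1 r) u) (partial 1 (partial 1 r) u)
    (partial 0 (partial 0 (partial 0 r)) u)
    (partial 0 (partial 0 (partial 1 r)) u)
    (partial 0 (partial 1 (partial 1 r)) u)
    (partial 1 (partial 1 (partial 1 r)) u)
    (k1 u) (k2 u) (dk1 u) (dk2 u) n1 n2.
  exact (And4 (kr Uu) (killing_d0 Uu) e2 (And3 (killing_d00 Uu) f2 f3)).
(* The components of the trace are N_1 and N_2 divided by d, with t c split into two halves for the
   two mixed terms. The form is homogeneous, so the factor does not affect its vanishing. *)
have scale (s t c0 c1 c2 c3 q0 q1 : R) : s ^+ 2 + t ^+ 2 / 4 != 0 ->
    - s * (- s * (c0 - c2) + t * c1) ^+ 2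
    + t * (- s * (c0 - c2) + t * c1) * (- s * (c1 - c3) + t * c2)
    + s * (- s * (c1 - c3) + t * c2) ^+ 2 = 0 ->
    q0 = (s ^+ 2 + t ^+ 2 / 4)^-1 * (- s * (c0 - c2) + t / 2 * (c1 + c1)) ->
    q1 = (s ^+ 2 + t ^+ 2 / 4)^-1 * (- s * (c1 - c3) + t / 2 * (c2 + c2)) ->
    - s * q0 ^+ 2 + t * q0 * q1 + s * q1 ^+ 2 = 0.
  move: (s ^+ 2 + _) => d d0' H -> ->.
  by rewrite -[RHS](mulr0 (d^-1 ^+ 2)) -[in RHS]H; field.
exact (scale _ _ _ _ _ _ _ _ d0 (killing_jet_null n0 kj d0)
  (trace_eq _ _ _ _ _ _ _ _ _ _ _ _ (VJ _) (etrans (covariant_Jmul 0 0 0 Uu) C0)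
     (etrans (covariant_Jmul 0 1 1 Uu) C2'') (etrans (covariant_Jmul 0 0 1 Uu)
       C1')
     (etrans (covariant_Jmul 0 1 0 Uu) C1''))
  (trace_eq _ _ _ _ _ _ _ _ _ _ _ _ (VJ _) (etrans (covariant_Jmul 1 0 0 Uu) C1)
     (etrans (covariant_Jmul 1 1 1 Uu) C3) (etrans (covariant_Jmul 1 0 1 Uu) C2)
     (etrans (covariant_Jmul 1 1 0 Uu) C2'))).
Qed.

End Killing.
End Jets.

(** * From the complex section to its real potentials *)

Section SupportFunction.
Context {R : realType}.
Local Open Scope complex_scope.

Lemma support_function_potential U (F : 'rV[R]_2 -> R[i]) r u :
  support_function U F r -> U u ->
  complex.Re (F u) = potential r 0 u /\ complex.Im (F u) = potential r 1 u.
Proof.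
case=> _ FE Uu; rewrite (FE _ Uu) /dbar /toC /potential.
move: (partial 0 r u) (partial 1 r u) (u 0 0) (u 0 1) => p q x y.
have -> : 1 + (x +i* y) * (x +i* y)^* = conformal x y +i* 0.
  by apply/eqP; rewrite eq_complex /=; apply/andP; split; apply/eqP;
    rewrite /conformal; ring.
have -> : 2 = 2 +i* 0 :> R[i] by apply/eqP; rewrite eq_complex /= addr0 !eqxx.
rewrite expr2 !invc_real; move: (conformal x y) => d /=.
by split; field.
Qed.

End SupportFunction.

Theorem theorem1 (R : realType) (U : set 'rV[R]_2) (F : 'rV[R]_2 -> R[i])
  (hF : smooth_section U F)
  (hL : lagrangian_on U F)
  (hS : rotationally_symmetric U F)
  (hN : nondegenerate_on neutral_metric (graph F) U) :
  marginally_trapped_on neutral_metric (graph F) U.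
Proof.
have [oU _ _] := hF.
have [r [rF [A [[AAT _] inv]]]] := hS.
have sr : smooth_on U r by case: rF.
have [n1 [n2 [n3 [n0 kr]]]] := rotational_killing oU sr AAT inv.
move=> u Uu; apply: (mean_curvature_null oU sr _ kr n0 Uu); last exact: hN.
move=> v; exact: support_function_potential rF.
Qed.
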